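(* Let $(V,E)$ be a multigraph with no isolated vertex, with uniform components $(V_m,E_m)$, $m\in\mathbb{N}$. Let $\beta:L^2(E)\to L^2(E)\otimes\mathcal{A}$ be a co-action of a compact quantum group $(\mathcal{A},\Delta)$ on $(V,E)$ preserving its quantum symmetry in our sense. Then for any $m\in\mathbb{N}$ with $E_m\neq\emptyset$, $$\beta(L^2(E_m))\subseteq L^2(E_m)\otimes\mathcal{A}.$$ Conversely, let $\{\beta_m: m\in\mathbb{N},E_m\neq\emptyset\}$ be a family of co-actions of a compact quantum group $(\mathcal{A},\Delta)$ preserving quantum symmetries (in our sense) of the uniform components $(V_m,E_m)$, such that the induced permutations $\alpha_m$ on the sets of vertices $V_m$ agree on the common regions, that is, for all $m\neq n$, $$\alpha_m|_{C(V_m\cap V_n)}=\alpha_n|_{C(V_m\cap V_n)}.$$ Then $\beta=\bigoplus_m\beta_m$ is a co-action on $(V,E)$ preserving its quantum symmetry in our sense.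
   Context: **Multigraphs.** A multigraph $(V,E)$ consists of finite sets $V$, $E$ with source and target maps $s,t:E\to V$. No isolated vertex: every vertex is the source or target of some edge. $E^i=\{\tau:s(\tau)=i\}$, $E_j=\{\tau:t(\tau)=j\}$, $E^i_j=E^i\cap E_j$, $V^s=s(E)$, $V^t=t(E)$. For a positive integer $m$, the uniform component of degree $m$ is the multi-subgraph $(V_m,E_m)$ with $E_m=\{\tau\in E:|E^{s(\tau)}_{t(\tau)}|=m\}$ and $V_m=\{v\in V: v=s(\tau)\text{ or }v=t(\tau)\text{ for some }\tau\in E_m\}$. Thus $E=\sqcup_mE_m$ and $V=\cup_mV_m$. **Function spaces.** For a finite set $X$, $C(X)$ is the algebra of functions on $X$ with basis the characteristic functions $\chi_x$; $L^2(X)$ is the same space as a Hilbert space with orthonormal basis $(\chi_x)$. For $Y\subseteq X$, $C(Y)\subseteq C(X)$, $L^2(Y)\subseteq L^2(X)$ are spans of $\{\chi_y:y\in Y\}$; the maps $\alpha_m$ are regarded with values in $C(V_m)\otimes\mathcal{A}\subseteq C(V)\otimes\mathcal{A}$. $L^2(E)$ is a $C(V)$-$C(V)$ bimodule by $\chi_i.\chi_\tau=\delta_{i,s(\tau)}\chi_\tau$, $\chi_\tau.\chi_j=\delta_{t(\tau),j}\chi_\tau$, extended by $(f\otimes a)(\xi\otimes b)=f.\xi\otimes ab$, $(\xi\otimes b)(f\otimes a)=\xi.f\otimes ba$. $p_\tau\in B(L^2(E))$ is the projection onto $\mathbb{C}\chi_\tau$; $D=\mathrm{span}\{p_\tau\}$;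 $S(\chi_v)=\sum_{\tau\in E^v}p_\tau$ ($v\in V^s$), $T(\chi_w)=\sum_{\tau\in E_w}p_\tau$ ($w\in V^t$) define $S:C(V^s)\to B(L^2(E))$, $T:C(V^t)\to B(L^2(E))$. For $E^i_j\neq\emptyset$: $p_{ij}=\sum_{\tau\in E^i_j}p_\tau$, $D_{ij}=p_{ij}Dp_{ij}$. **Compact quantum groups** are in Woronowicz's sense; tensor products minimal. A co-representation on $L^2(E)$: linear $\beta$, $\beta(\chi_\tau)=\sum_\sigma\chi_\sigma\otimes u^\sigma_\tau$, $\Delta(u^\sigma_\tau)=\sum_\kappa u^\sigma_\kappa\otimes u^\kappa_\tau$, with matrix $U=(u^\sigma_\tau)$; contragradient $\overline\beta$ has matrix $(u^{\sigma*}_\tau)$; bi-unitary means both matrices are unitary. $Ad_\beta(X)=U(X\otimes1)U^*$ (similarly $Ad_{\overline\beta}$). A co-action on a unital C*-algebra $\mathcal{B}$ is a unital $*$-homomorphism $\alpha:\mathcal{B}\to\mathcal{B}\otimes\mathcal{A}$ with $(\alpha\otimes id)\alpha=(id\otimes\Delta)\alpha$ and $\mathrm{span}\,\alpha(\mathcal{B})(1\otimes\mathcal{A})$ norm-dense. **Quantum symmetry.** A bi-unitary co-representation $\beta$ on $L^2(E)$ is a co-action on $(V,E)$ preserving its quantum symmetry *in Banica's sense* if: (1) $Ad_\beta(S(C(V^s)))\subseteq S(C(V^s))\otimes\mathcal{A}$; (2) $Ad_{\overline\beta}(T(C(V^t)))\subseteq T(C(V^t))\otimes\mathcal{A}$;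 (3) the induced co-actions $\alpha_s$ on $C(V^s)$, $\alpha_t$ on $C(V^t)$ (the unique co-actions with $\alpha_s(\chi_i)\beta(\chi_\tau)=\beta(\chi_i.\chi_\tau)$, $\beta(\chi_\tau)\alpha_t(\chi_j)=\beta(\chi_\tau.\chi_j)$ for $i\in V^s,j\in V^t,\tau\in E$; they exist under (1),(2)) preserve and agree on $C(V^s\cap V^t)$; (4) $\beta(\xi_0)=\xi_0\otimes1$, $\xi_0=\sum_{\tau\in E}\chi_\tau$. The induced permutation on the set of vertices is the co-action $\alpha$ on $C(V)$ with $\alpha(\chi_k)=\alpha_s(\chi_k)$ for $k\in V^s$, $\alpha(\chi_k)=\alpha_t(\chi_k)$ for $k\in V^t$. $\beta$ preserves quantum symmetry *in our sense* if moreover, for all $i,j,k,l$ with $E^i_j\ne\emptyset\neq E^k_l$ and all $X\in D_{ij}$, $(p_{kl}\otimes1)Ad_\beta(X)(p_{kl}\otimes1)\in D_{kl}\otimes\mathcal{A}$ and $(p_{kl}\otimes1)Ad_{\overline\beta}(X)(p_{kl}\otimes1)\in D_{kl}\otimes\mathcal{A}$. The same definitions apply to each multigraph $(V_m,E_m)$. *)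

(* Defs.v *)
From mathcomp Require Import all_boot all_order all_algebra.
From mathcomp Require Import complex.
From mathcomp Require Import all_classical all_reals all_analysis.

Set Implicit Arguments.
Unset Strict Implicit.
Unset Printing Implicit Defensive.

Import Order.TTheory GRing.Theory Num.Theory.

Local Open Scope classical_set_scope.
Local Open Scope ring_scope.
Local Open Scope complex_scope.

Definition lspan (K : pzRingType) (W : lmodType K) (S : set W) : set W :=
  [set w | exists (n : nat) (c : 'I_n -> K) (s : 'I_n -> W),
     (forall i, S (s i)) /\ w = \sum_(i < n) c i *: s i].

Definition finsums (W : nmodType) (S : set W) : set W :=
  [set w | exists (n : nat) (s : 'I_n -> W),
     (forall i, S (s i)) /\ w = \sum_(i < n) s i].

(* For K = R[i], [{ffun X -> K^o}] is both C(X) and L^2(X), with basis [chi x]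
   (K^o is K as a module over itself); for an algebra B, [{ffun X -> B}] is
   C(X) (x) B and L^2(X) (x) B, where f (x) b is [ftens f b]. *)

Definition chi (K : pzRingType) (X : finType) (x : X) : {ffun X -> K^o} :=
  [ffun y => (y == x)%:R].

(* C(Y) (or L^2(Y)) as a subspace of C(X) (or L^2(X)) *)
Definition fspan (K : pzRingType) (X : finType) (Y : {set X}) :
    set {ffun X -> K^o} :=
  lspan [set f | exists2 y, y \in Y & f = chi K y].

Arguments fspan : clear implicits.
Arguments fspan K {X} Y _.

Definition ftens (K : pzRingType) (W : lmodType K) (X : finType)
    (f : {ffun X -> K^o}) (a : W) : {ffun X -> W} :=
  [ffun x => (f x : K) *: a].

(* F (x) W for a subspace F; the elementary tensors are stable under scaling,
   so their finite sums are their span. *)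
Definition ftens_set (K : pzRingType) (W : lmodType K) (X : finType)
    (F : set {ffun X -> K^o}) : set {ffun X -> W} :=
  finsums [set h | exists (f : {ffun X -> K^o}) (a : W), F f /\ h = ftens f a].

(* [fext] extends by 0, which is the embedding of C(Y) in C(X). *)
Definition fext (W : nmodType) (X : finType) (Y : {set X})
    (f : {ffun {x : X | x \in Y} -> W}) : {ffun X -> W} :=
  [ffun x => if insub x is Some y then f y else 0].

Definition fres (W : nmodType) (X : finType) (Y : {set X})
    (f : {ffun X -> W}) : {ffun {x : X | x \in Y} -> W} :=
  [ffun y => f (val y)].

(* A bundled record: Hierarchy Builder does not accept a join of
   [completeNormedModType] and [algType]. *)
Record cstarType (R : realType) := CStar {
  cstar_alg :> algType R[i] ;
  star : cstar_alg -> cstar_alg ;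
  cnorm : cstar_alg -> R ;
  starD : forall x y, star (x + y) = star x + star y ;
  starZ : forall (c : R[i]) x, star (c *: x) = c^*%C *: star x ;
  starM : forall x y, star (x * y) = star y * star x ;
  starK : forall x, star (star x) = x ;
  cnorm_ge0 : forall x, 0 <= cnorm x ;
  cnorm_eq0 : forall x, cnorm x = 0 -> x = 0 ;
  cnormZ : forall (c : R[i]) x, (cnorm (c *: x))%:C = `|c| * (cnorm x)%:C ;
  cnormD : forall x y, cnorm (x + y) <= cnorm x + cnorm y ;
  cnormM : forall x y, cnorm (x * y) <= cnorm x * cnorm y ;
  cnorm_star : forall x, cnorm (star x * x) = cnorm x ^+ 2 ;
  cnorm_complete : forall u : nat -> cstar_alg,
    (forall e : R, 0 < e -> exists N, forall m n, (N <= m)%N -> (N <= n)%N ->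
       cnorm (u m - u n) < e) ->
    exists l, forall e : R, 0 < e -> exists N, forall n, (N <= n)%N ->
      cnorm (u n - l) < e
}.

Definition cdense (R : realType) (A : cstarType R) (S : set A) : Prop :=
  forall (x : A) (e : R), 0 < e -> exists2 y, S y & cnorm (x - y) < e.

Record star_hom (R : realType) (A B : cstarType R) (f : A -> B) : Prop := {
  star_hom_linear : linear f ;
  star_hom1 : f 1 = 1 ;
  star_homM : forall x y, f (x * y) = f x * f y ;
  star_homS : forall x, f (star x) = star (f x)
}.

Record state (R : realType) (A : cstarType R) (phi : A -> R[i]) : Prop := {
  state_linear : linear (phi : A -> R[i]^o) ;
  state1 : phi 1 = 1 ;
  state_ge0 : forall x, 0 <= phi (star x * x)
}.

(* A list of pairs (a_i, b_i) stands for the algebraic tensor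
   \sum_i a_i (x) b_i. *)

Definition tstar (R : realType) (A B : cstarType R) (x : seq (A * B)) :
    seq (A * B) :=
  [seq (star p.1, star p.2) | p <- x].

Definition tmul (R : realType) (A B : cstarType R) (x y : seq (A * B)) :
    seq (A * B) :=
  [seq (p.1 * q.1, p.2 * q.2) | p <- x, q <- y].

Definition tstate (R : realType) (A B : cstarType R)
    (phi : A -> R[i]) (psi : B -> R[i]) (x : seq (A * B)) : R[i] :=
  \sum_(p <- x) phi p.1 * psi p.2.

(* [spatial_le x r] says that the spatial (minimal) C*-norm of x is at most r:
   for all states phi and psi, the norm of (pi_phi (x) pi_psi)(x) is at most r,
   where pi_phi and pi_psi are the GNS representations.  The vectors
   (pi_phi (x) pi_psi)(c) (Omega_phi (x) Omega_psi) are dense in the tensor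
   product of the GNS spaces, and the square of the norm of such a vector is
   (phi (x) psi)(c^* c). *)
Definition spatial_le (R : realType) (A B : cstarType R) (x : seq (A * B))
    (r : R) : Prop :=
  forall (phi : A -> R[i]) (psi : B -> R[i]), state phi -> state psi ->
  forall c : seq (A * B),
    tstate phi psi (tmul (tstar (tmul x c)) (tmul x c))
      <= (r ^+ 2)%:C * tstate phi psi (tmul (tstar c) c).

(* [T], with [t a b] for a (x) b, is the minimal tensor product of A and B. *)
Record min_tensor (R : realType) (A B T : cstarType R) (t : A -> B -> T) :
    Prop := {
  min_tensor_linl : forall b, linear (t^~ b) ;
  min_tensor_linr : forall a, linear (t a) ;
  min_tensor1 : t 1 1 = 1 ;
  min_tensorM : forall a a' b b', t a b * t a' b' = t (a * a') (b * b') ;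
  min_tensorS : forall a b, star (t a b) = t (star a) (star b) ;
  min_tensor_norm : forall (x : seq (A * B)) (r : R), 0 <= r ->
    (cnorm (\sum_(p <- x) t p.1 p.2) <= r <-> spatial_le x r) ;
  min_tensor_dense : cdense (lspan [set z | exists a b, z = t a b])
}.

(* The models [qg2] of A (x) A and [qg3] of A (x) A (x) A are part of the
   data; [qg_l] and [qg_r] present [qg3] as (A (x) A) (x) A and
   A (x) (A (x) A).  In [qg_coassoc], D1 is Delta (x) id and D2 is
   id (x) Delta; a star-homomorphism is bounded, so the elementary tensors
   determine both. *)
Record cqg (R : realType) := CQG {
  qg_alg :> cstarType R ;
  qg2 : cstarType R ;
  qg3 : cstarType R ;
  qg_t : qg_alg -> qg_alg -> qg2 ;
  qg_l : qg2 -> qg_alg -> qg3 ;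
  qg_r : qg_alg -> qg2 -> qg3 ;
  qg_tP : min_tensor qg_t ;
  qg_lP : min_tensor qg_l ;
  qg_rP : min_tensor qg_r ;
  qg_lr : forall a b c, qg_l (qg_t a b) c = qg_r a (qg_t b c) ;
  qg_Delta : qg_alg -> qg2 ;
  qg_Delta_hom : star_hom qg_Delta ;
  qg_coassoc : exists D1 D2 : qg2 -> qg3,
    [/\ star_hom D1 /\ forall a b, D1 (qg_t a b) = qg_l (qg_Delta a) b,
        star_hom D2 /\ forall a b, D2 (qg_t a b) = qg_r a (qg_Delta b)
      & forall a, D1 (qg_Delta a) = D2 (qg_Delta a)] ;
  qg_densel : cdense (lspan [set z | exists a b, z = qg_Delta a * qg_t b 1]) ;
  qg_denser : cdense (lspan [set z | exists a b, z = qg_Delta a * qg_t 1 b])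
}.

(* Co-actions on the C*-algebra C(X).  The C*-norm of C(X) (x) A = C(X, A) is
   the supremum norm. *)
Record coaction (R : realType) (Q : cqg R) (X : finType)
    (al : {ffun X -> R[i]^o} -> {ffun X -> Q}) : Prop := {
  coaction_linear : linear al ;
  coaction1 : al 1 = 1 ;
  coactionM : forall f g, al (f * g) = al f * al g ;
  coactionS : forall f : {ffun X -> R[i]^o},
    al [ffun x => (f x)^*%C] = [ffun x => star (al f x)] ;
  (* (al (x) id) al = (id (x) Delta) al *)
  coactionA : forall f y,
    \sum_(x : X) qg_t (al (chi _ x) y) (al f x) = qg_Delta (al f y) ;
  coaction_dense : forall (h : {ffun X -> Q}) (e : R), 0 < e ->
    exists2 g, lspan [set k | exists (f : {ffun X -> R[i]^o}) (a : Q),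
                        k = al f * ftens 1 a] g
             & forall x, cnorm (h x - g x) < e
}.

Record multigraph := MultiGraph {
  vert : finType ;
  edge : finType ;
  src : edge -> vert ;
  tgt : edge -> vert
}.

Definition no_isolated_vertex (G : multigraph) : Prop :=
  forall v : vert G, exists e : edge G, src e = v \/ tgt e = v.

Definition Vs (G : multigraph) : {set vert G} := [set src e | e : edge G]%SET.
Definition Vt (G : multigraph) : {set vert G} := [set tgt e | e : edge G]%SET.

(* E^i_j *)
Definition Eij (G : multigraph) (i j : vert G) : {set edge G} :=
  [set e | (src e == i) && (tgt e == j)]%SET.

Definition Em (G : multigraph) (m : nat) : {set edge G} :=
  [set e : edge G | #|Eij (src e) (tgt e)| == m]%SET.

Definition Vm (G : multigraph) (m : nat) : {set vert G} :=
  [set v | [exists e in Em G m, (v == src e) || (v == tgt e)]]%SET.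

Lemma src_Vm (G : multigraph) (m : nat) (e : {e : edge G | e \in Em G m}) :
  src (val e) \in Vm G m.
Proof.
rewrite inE; apply/existsP; exists (val e); apply/andP; split; first exact: valP.
by rewrite eqxx.
Qed.

Lemma tgt_Vm (G : multigraph) (m : nat) (e : {e : edge G | e \in Em G m}) :
  tgt (val e) \in Vm G m.
Proof.
rewrite inE; apply/existsP; exists (val e); apply/andP; split; first exact: valP.
by rewrite eqxx orbT.
Qed.

Definition uniform_component (G : multigraph) (m : nat) : multigraph :=
  @MultiGraph {v : vert G | v \in Vm G m} {e : edge G | e \in Em G m}
    (fun e => Sub (src (val e)) (src_Vm e))
    (fun e => Sub (tgt (val e)) (tgt_Vm e)).

(* B(L^2(E)) (x) B is the algebra of B-valued matrices indexed by E, which is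
   enumerated by [enum_val]. *)

Definition mtens (K : pzRingType) (W : lmodType K) (n : nat)
    (X : 'M[K]_n) (a : W) : 'M[W]_n := map_mx (fun c => c *: a) X.

Definition mtens_set (K : pzRingType) (W : lmodType K) (n : nat)
    (F : set 'M[K]_n) : set 'M[W]_n :=
  finsums [set Y | exists X (a : W), F X /\ Y = mtens X a].

Definition mconj (R : realType) (A : cstarType R) (n : nat) (U : 'M[A]_n) :
  'M[A]_n := map_mx (@star _ A) U.

Definition madj (R : realType) (A : cstarType R) (n : nat) (U : 'M[A]_n) :
  'M[A]_n := (mconj U)^T.

Definition munitary (R : realType) (A : cstarType R) (n : nat)
    (U : 'M[A]_n) : Prop :=
  U *m madj U = 1%:M /\ madj U *m U = 1%:M.

Definition Ad (R : realType) (A : cstarType R) (n : nat) (U : 'M[A]_n)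
    (X : 'M[R[i]]_n) : 'M[A]_n :=
  U *m mtens X (1 : A) *m madj U.

Section EdgeOperators.
Variables (K : pzRingType) (G : multigraph).
Local Notation BL2 := 'M[K]_#|edge G|.

Definition pE (e : edge G) : BL2 := delta_mx (enum_rank e) (enum_rank e).

Definition pij (i j : vert G) : BL2 := \sum_(e in Eij i j) pE e.

Definition Dalg : set BL2 := lspan (range pE).

Definition Dij (i j : vert G) : set BL2 :=
  [set pij i j *m X *m pij i j | X in Dalg].

Definition Smap (f : {ffun {v : vert G | v \in Vs G} -> K^o}) : BL2 :=
  \sum_v (f v : K) *: \sum_(e | src e == val v) pE e.

Definition Tmap (f : {ffun {v : vert G | v \in Vt G} -> K^o}) : BL2 :=
  \sum_v (f v : K) *: \sum_(e | tgt e == val v) pE e.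

End EdgeOperators.

(* The bimodule structure of L^2(E) (x) B over C(V) (x) B, where B is the base
   field or A. *)
Definition lact (B : pzRingType) (G : multigraph) (f : {ffun vert G -> B})
    (xi : {ffun edge G -> B}) : {ffun edge G -> B} :=
  [ffun e => f (src e) * xi e].

Definition ract (B : pzRingType) (G : multigraph) (xi : {ffun edge G -> B})
    (f : {ffun vert G -> B}) : {ffun edge G -> B} :=
  [ffun e => xi e * f (tgt e)].

Section QuantumSymmetry.
Variables (R : realType) (Q : cqg R) (G : multigraph).
Variable beta : {ffun edge G -> R[i]^o} -> {ffun edge G -> Q}.
Local Notation C := R[i].

(* [u x y] is u^x_y *)
Let u (x y : edge G) : Q := beta (chi C y) x.

Definition is_corep : Prop :=
  linear beta /\
  forall x y : edge G, qg_Delta (u x y) = \sum_z qg_t (u x z) (u z y).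

Definition corep_mx : 'M[Q]_#|edge G| :=
  \matrix_(i, j) u (enum_val i) (enum_val j).

Definition contra_mx : 'M[Q]_#|edge G| := mconj corep_mx.

Definition biunitary : Prop := munitary corep_mx /\ munitary contra_mx.

Definition induced_src
    (als : {ffun {v : vert G | v \in Vs G} -> C^o} ->
           {ffun {v : vert G | v \in Vs G} -> Q}) : Prop :=
  coaction als /\
  forall i (e : edge G),
    lact (fext (als (chi C i))) (beta (chi C e)) =
    beta (lact (chi C (val i)) (chi C e)).

Definition induced_tgt
    (alt : {ffun {v : vert G | v \in Vt G} -> C^o} ->
           {ffun {v : vert G | v \in Vt G} -> Q}) : Prop :=
  coaction alt /\
  forall j (e : edge G),
    ract (beta (chi C e)) (fext (alt (chi C j))) =
    beta (ract (chi C e) (chi C (val j))).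

(* "The" induced co-actions are unique, whence the existential quantifiers
   over them here and in [induced_perm]. *)
Definition preserves_and_agrees : Prop :=
  exists als alt, [/\ induced_src als, induced_tgt alt &
    forall f : {ffun vert G -> C^o}, fspan C (Vs G :&: Vt G)%SET f ->
      [/\ ftens_set (fspan C (Vs G :&: Vt G)%SET) (fext (als (fres (Vs G) f))),
          ftens_set (fspan C (Vs G :&: Vt G)%SET) (fext (alt (fres (Vt G) f)))
        & fext (als (fres (Vs G) f)) = fext (alt (fres (Vt G) f))]].

Definition preserves_Banica : Prop :=
  is_corep /\ biunitary /\
  [/\ forall X, range (@Smap C G) X ->
        mtens_set (range (@Smap C G)) (Ad corep_mx X),
      forall X, range (@Tmap C G) X ->
        mtens_set (range (@Tmap C G)) (Ad contra_mx X),
      preserves_and_agrees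
    & beta (\sum_e chi C e) = ftens (\sum_e chi C e) 1].

(* The notion of quantum symmetry that refines Banica's by a condition on the
   blocks E^i_j. *)
Definition preserves_symmetry : Prop :=
  preserves_Banica /\
  forall i j k l : vert G, Eij i j != finset.set0 -> Eij k l != finset.set0 ->
  forall X, Dij i j X ->
    mtens_set (Dij k l)
      (mtens (pij C k l) (1 : Q) *m Ad corep_mx X *m mtens (pij C k l) 1) /\
    mtens_set (Dij k l)
      (mtens (pij C k l) (1 : Q) *m Ad contra_mx X *m mtens (pij C k l) 1).

Definition induced_perm (al : {ffun vert G -> C^o} -> {ffun vert G -> Q}) :
    Prop :=
  coaction al /\
  exists als alt, [/\ induced_src als, induced_tgt alt,
    forall k, al (chi C (val k)) = fext (als (chi C k)) &
    forall k, al (chi C (val k)) = fext (alt (chi C k))].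

End QuantumSymmetry.

(* The direct sum of the beta_m on L^2(E) = \bigoplus_m L^2(E_m); the sum can
   stop at #|E|, and the m with E_m empty contribute 0. *)
Definition corep_sum (R : realType) (Q : cqg R) (G : multigraph)
    (beta : forall m, {ffun edge (uniform_component G m) -> R[i]^o} ->
                      {ffun edge (uniform_component G m) -> Q}) :
    {ffun edge G -> R[i]^o} -> {ffun edge G -> Q} :=
  fun xi => \sum_(m < #|edge G|.+1)
    @fext _ _ (Em G m) (beta m (fres (Em G m) xi)).

(* Main.v *)
Require Import Defs.
From mathcomp Require Import all_boot all_order all_algebra.
From mathcomp Require Import complex.
From mathcomp Require Import all_classical all_reals all_analysis.
From mathcomp Require Import ring lra.

(** Write [u x y] for the coefficients of [beta], [qs] and [qt] for those of
    the co-actions induced on sources and targets.  The bimodule relations say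
    [qs (src e) i * u e f = u e f] if [i = src f] and [0] otherwise, and the
    same for [qt] on the right.

    Direct part.  Take edges [e], [f] and let [p] be the product
    [qs (src e) (src f) * qt (tgt e) (tgt f)].  Since [beta] fixes the sum of
    all edges, each row of [u] sums to 1, and by unitarity so does each column.
    Cutting these sums with [qs] and [qt] shows that, in the block of [u] whose
    rows are the edges parallel to [e] and whose columns are those parallel to
    [f], every row and every column sums to [p].  Adding up the whole block in
    two ways gives [n p = m p], where [n] and [m] are the multiplicities of [e]
    and [f].  So [p = 0] when they differ, and then the column of [f] in that
    block sums to 0; its entries are mutually orthogonal by the block condition
    of the definition, hence each of them vanishes ([coef_mult]).

    The cut of a column needs [qs] and [qt] to be orthogonal along their
    columns, i.e. to be magic unitaries ([magic_of_unitary]).  Let [d k] be the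
    number of edges with source [k].  Then [d k] times the projection [qs k i]
    is the sum of [u e f * star (u e f)] over the edges [e] from [k] and [f]
    from [i].  Bi-unitarity bounds this sum by [d i], so [qs k i] is 0 unless
    [d k <= d i]; comparing the two ways of weighing all the entries excludes
    [d k < d i] too, and the columns of [qs] sum to 1.

    Such arguments conclude from a vanishing sum of elements [y * star y] that
    each [y] is 0 ([sum_mulstar_eq0]).  In an abstract C*-algebra this is the
    theorem that [a * star a] is positive, proved in the first part from square
    roots obtained by iteration.

    Converse part.  The [alpha m] agree on overlaps, so they are the
    restrictions of one matrix [glued].  A magic unitary which preserves
    a set of indices preserves its complement ([magic_complement]), so the
    entries of [glued] between a component and the vertices outside it vanish
    in both directions, and [glued] is a magic unitary on the sources and on
    the targets of the whole multigraph ([magic_cover]).  A magic unitary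
    compatible with the co-multiplication defines a co-action
    ([magic_coaction]).  As [u] is block diagonal, all other conditions are
    those of the components. *)

Set Implicit Arguments.
Unset Strict Implicit.
Unset Printing Implicit Defensive.

Import Order.TTheory GRing.Theory Num.Theory.

Local Open Scope classical_set_scope.
Local Open Scope ring_scope.
Local Open Scope complex_scope.

(** * Positive elements of a C*-algebra *)
Section CStarAlgebra.
Variables (R : realType) (A : cstarType R).
Implicit Types (x y z w a b h s : A) (t r e : R).

Local Notation N := (@cnorm R A).
Local Notation "r *:: x" := (r%:C *: x) (at level 40).
Local Notation sa x := (star x = x).
Local Notation ii := ('i%C : R[i]).

Lemma star0 : star (0 : A) = 0.
Proof. by apply: (addrI (star (0 : A))); rewrite -starD !addr0. Qed.

Lemma starN x : star (- x) = - star x.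
Proof. by apply: (addrI (star x)); rewrite -starD !subrr star0. Qed.

Lemma starB x y : star (x - y) = star x - star y.
Proof. by rewrite starD starN. Qed.

Lemma star1 : star (1 : A) = 1.
Proof. by rewrite -[RHS]starK -[star 1 in RHS]mulr1 starM starK mulr1. Qed.

Lemma star_sum (I : Type) (r : seq I) (P : pred I) (F : I -> A) :
  star (\sum_(i <- r | P i) F i) = \sum_(i <- r | P i) star (F i).
Proof. by elim/big_rec2: _ => [|i x y _ <-]; rewrite ?star0 ?starD. Qed.

Lemma starZr t x : star (t *:: x) = t *:: star x.
Proof. by rewrite starZ conjc_real. Qed.

Lemma cnorm0 : N 0 = 0.
Proof.
have := cnormZ (0 : R[i]) (0 : A).
by rewrite scaler0 normr0 mul0r => -[].
Qed.

Lemma cnormZr t x : N (t *:: x) = `|t| * N x.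
Proof.
have := cnormZ (t%:C) x; rewrite normc_def /= expr0n /= addr0 sqrtr_sqr.
by rewrite -(rmorphM (real_complex R)) => -[].
Qed.

Lemma cnormN x : N (- x) = N x.
Proof. by rewrite -scaleN1r -(rmorphN1 (real_complex R)) cnormZr normrN1 mul1r. Qed.

Lemma cnormB x y : N (x - y) <= N x + N y.
Proof. by rewrite -(cnormN y) cnormD. Qed.

Lemma cnormC x y : N (x - y) = N (y - x).
Proof. by rewrite -cnormN opprB. Qed.

(** The C*-identity gives [N y ^+ 2 <= N (star y) * N y], hence one inequality
    for every [y]; the other one is the case [star y]. *)
Lemma cnorm_starE x : N (star x) = N x.
Proof.
have le y : N y <= N (star y).
  have [->|y0] := eqVneq (N y) 0; first exact: cnorm_ge0.
  have yp : 0 < N y by rewrite lt_neqAle eq_sym y0 cnorm_ge0.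
  by rewrite -(ler_pM2r yp) -expr2 -cnorm_star cnormM.
by apply/eqP; rewrite eq_le le andbT -{2}(starK x) le.
Qed.

Lemma cnorm_mulstar x : N (x * star x) = N x ^+ 2.
Proof. by rewrite -{1}(starK x) cnorm_star cnorm_starE. Qed.

Lemma cnorm1 : N 1 = 1.
Proof.
have n0 : N 1 != 0 by apply/eqP => /cnorm_eq0/eqP; rewrite oner_eq0.
have := cnorm_star (1 : A); rewrite star1 mulr1 expr2 => h.
by apply: (mulfI n0); rewrite mulr1 -h.
Qed.

Lemma cnorm_sa x : sa x -> N (x * x) = N x ^+ 2.
Proof. by move=> xs; rewrite -cnorm_star xs. Qed.

(** The form in which limits are used below: an element whose norm is bounded
    by a fixed multiple of every positive number is 0. *)
Lemma cnorm_eps x (c : R) : (forall e, 0 < e -> N x <= c * e) -> x = 0.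
Proof.
move=> h; apply: cnorm_eq0; apply/eqP; rewrite eq_le cnorm_ge0 andbT.
have cp : 0 < `|c| + 1 by rewrite ltr_wpDl.
apply/ler_addgt0Pl => e e0; rewrite addr0.
apply: (le_trans (h (e / (`|c| + 1)) _)); first exact: divr_gt0.
rewrite mulrCA ger_pMr // ler_pdivrMr // mul1r.
by apply: (le_trans (ler_norm _)); rewrite lerDl.
Qed.

(** If [z] is a fixed point of [z |-> (y + z^2) / 2], then [1 - z] is a square
    root of [1 - y]. *)
Fixpoint root_seq y n : A :=
  if n is n'.+1 then 2^-1 *:: (y + root_seq y n' * root_seq y n') else 0.

(** The same iteration for the number 1.  It increases to 1, and it majorises
    the iteration for every [y] with [N y <= 1]; this gives convergence on the
    closed ball, where the iteration is not a strict contraction. *)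
Fixpoint root_bound n : R :=
  if n is n'.+1 then 2^-1 * (1 + root_bound n' * root_bound n') else 0.

Lemma root_bound_itv n : 0 <= root_bound n <= 1.
Proof. elim: n => [|n /andP[h0 h1]] /=; first by rewrite lexx ler01. nra. Qed.

Lemma root_bound_cauchy e : 0 < e ->
  exists n0, forall n, (n0 <= n)%N -> root_bound n - root_bound n0 < e.
Proof.
move=> e0; pose S : set R := range root_bound.
have hS : has_sup S.
  split; first by exists (root_bound 0), 0%N.
  by exists 1 => _ [n _ <-]; case/andP: (root_bound_itv n).
have [_ [n0 _ <-] hn] := sup_adherent e0 hS.
exists n0 => n _.
have : root_bound n <= sup S.
  by apply: sup_upper_bound => //; exists n.
lra.
Qed.

Lemma root_seq_norm y n : N y <= 1 -> N (root_seq y n) <= root_bound n.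
Proof.
move=> y1; elim: n => [|n IH]; first by rewrite /= cnorm0.
rewrite [root_seq _ _]/= [root_bound _]/= cnormZr ger0_norm ?invr_ge0 ?ler0n //.
rewrite ler_pM2l ?invr_gt0 ?ltr0n //.
apply: (le_trans (cnormD _ _)); apply: lerD => //.
by apply: (le_trans (cnormM _ _)); apply: ler_pM => //; exact: cnorm_ge0.
Qed.

(** The difference of two steps is [((u - v) u + v (u - v)) / 2], also when [u]
    and [v] do not commute, and the bounds satisfy the same identity. *)
Lemma root_seq_step y n : N y <= 1 ->
  N (root_seq y n.+1 - root_seq y n) <= root_bound n.+1 - root_bound n.
Proof.
move=> y1; elim: n => [|n IH].
  by rewrite subr0 (le_trans (root_seq_norm _ y1)) //= subr0.
set u := root_seq y n.+1 in IH *; set v := root_seq y n in IH *.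
set p := root_bound n.+1 in IH *; set q := root_bound n in IH *.
have -> : root_seq y n.+2 - u = 2^-1 *:: ((u - v) * u + v * (u - v)).
  have Eu : u = 2^-1 *:: (y + v * v) by [].
  have -> : root_seq y n.+2 = 2^-1 *:: (y + u * u) by [].
  rewrite [X in _ - X]Eu -scalerBr.
  congr (_ *: _); rewrite opprD addrACA subrr add0r mulrBl mulrBr.
  by rewrite addrA subrK.
have -> : root_bound n.+2 - p = 2^-1 * ((p - q) * p + q * (p - q)).
  have Ep : p = 2^-1 * (1 + q * q) by [].
  have -> : root_bound n.+2 = 2^-1 * (1 + p * p) by [].
  by rewrite [X in _ - X]Ep; ring.
rewrite cnormZr ger0_norm ?invr_ge0 ?ler0n // ler_pM2l ?invr_gt0 ?ltr0n //.
apply: (le_trans (cnormD _ _)); apply: lerD;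
  apply: (le_trans (cnormM _ _)); apply: ler_pM => //;
  try exact: cnorm_ge0; exact: root_seq_norm.
Qed.

Lemma root_seq_dist y n k : N y <= 1 ->
  N (root_seq y (k + n) - root_seq y n) <= root_bound (k + n) - root_bound n.
Proof.
move=> y1; elim: k => [|k IH]; first by rewrite !add0n !subrr cnorm0.
rewrite addSn -[root_seq y _.+1](subrK (root_seq y (k + n))) -addrA.
apply: (le_trans (cnormD _ _)).
have := root_seq_step (k + n) y1; lra.
Qed.

Lemma root_seq_lim y : N y <= 1 ->
  exists z, forall e, 0 < e -> exists n0, forall n, (n0 <= n)%N ->
    N (root_seq y n - z) < e.
Proof.
move=> y1; apply: cnorm_complete => e e0.
have [n0 h] := root_bound_cauchy (divr_gt0 e0 (ltr0n R 2 : 0 < 2)).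
exists n0 => m n hm hn.
have d k : (n0 <= k)%N -> N (root_seq y k - root_seq y n0) < e / 2.
  move=> hk; apply: le_lt_trans (h k hk).
  by have := root_seq_dist n0 (k - n0) y1; rewrite subnK.
have -> : root_seq y m - root_seq y n =
  (root_seq y m - root_seq y n0) - (root_seq y n - root_seq y n0).
  by rewrite opprB addrA subrK.
apply: (le_lt_trans (cnormB _ _)).
have := d _ hm; have := d _ hn; lra.
Qed.

Lemma root_seq_sa y n : sa y -> sa (root_seq y n).
Proof.
by move=> ys; elim: n => [|n IH]; rewrite /= ?star0 // starZr starD starM ys IH.
Qed.

Lemma root_seq_comm y w n : w * y = y * w -> w * root_seq y n = root_seq y n * w.
Proof.
move=> c; elim: n => [|n IH]; rewrite /= ?mulr0 ?mul0r //.
rewrite -scalerAr -scalerAl; congr (_ *: _).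
by rewrite mulrDr mulrDl c mulrA IH -mulrA IH mulrA.
Qed.

(** [z] is the limit of [root_seq y], and each property passes to the limit:
    the terms are polynomials in [y], so they are self-adjoint and commute with
    all that commutes with [y]. *)
Lemma sqrt_one_sub y : sa y -> N y <= 1 ->
  exists z, [/\ sa z, N z <= 1, (1 - z) * (1 - z) = 1 - y &
    forall w, w * y = y * w -> w * z = z * w].
Proof.
move=> ys y1; have [z hz] := root_seq_lim y1.
have app e : 0 < e -> exists n, N (root_seq y n - z) < e /\
    N (root_seq y n.+1 - z) < e.
  by move=> e0; have [n h] := hz e e0; exists n; split; apply: h.
have u1 n : N (root_seq y n) <= 1.
  by apply: (le_trans (root_seq_norm n y1)); case/andP: (root_bound_itv n).
have z1 : N z <= 1.
  apply/ler_addgt0Pl => e e0; have [n [h _]] := app e e0.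
  rewrite -[z](subrK (root_seq y n)) (le_trans (cnormD _ _)) // lerD //.
  by rewrite cnormC ltW.
exists z; split => //.
- apply/eqP; rewrite -subr_eq0; apply/eqP.
  apply: (@cnorm_eps _ 2) => e e0; have [n [h _]] := app e e0.
  have -> : star z - z = (root_seq y n - z) - star (root_seq y n - z).
    by rewrite starB root_seq_sa // opprB addrCA addrAC subrr add0r.
  apply: (le_trans (cnormB _ _)); rewrite cnorm_starE; lra.
- have E : z + z = y + z * z.
    apply/eqP; rewrite -subr_eq0; apply/eqP.
    apply: (@cnorm_eps _ 4) => e e0; have [n [h1 h2]] := app e e0.
    set u := root_seq y n in h1; set v := root_seq y n.+1 in h2.
    have Ev : v + v = y + u * u.
      rewrite /v /= -/u -scalerDl -(rmorphD (real_complex R)).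
      by rewrite (_ : 2^-1 + 2^-1 = 1 :> R) ?scale1r //; lra.
    have -> : z + z - (y + z * z) =
        (u - z) * u + z * (u - z) - ((v - z) + (v - z)).
      rewrite mulrBl mulrBr addrA subrK [v - z + _]addrACA Ev -opprD.
      rewrite opprB addrCA !opprD; congr (_ + _).
      by rewrite [- y - u * u]addrC addrACA subrr add0r addrC.
    apply: (le_trans (cnormB _ _)).
    have a1 : N ((u - z) * u + z * (u - z)) <= e + e.
      apply: (le_trans (cnormD _ _)); apply: lerD;
        apply: (le_trans (cnormM _ _)).
        by rewrite -[e]mulr1; apply: ler_pM; rewrite ?cnorm_ge0 ?u1 ?z1 ?ltW.
      by rewrite -[e]mul1r; apply: ler_pM; rewrite ?cnorm_ge0 ?u1 ?z1 ?ltW.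
    have a2 := cnormD (v - z) (v - z).
    lra.
  have Ez : z * z - z = z - y.
    by apply/eqP; rewrite subr_eq addrAC E addrAC subrr add0r.
  by rewrite mulrBl !mulrBr !mulr1 mul1r opprB Ez addrA subrK.
- move=> w c; apply/eqP; rewrite -subr_eq0; apply/eqP.
  apply: (@cnorm_eps _ (2 * N w)) => e e0; have [n [h _]] := app e e0.
  have -> : w * z - z * w = (root_seq y n - z) * w - w * (root_seq y n - z).
    by rewrite mulrBl mulrBr root_seq_comm // opprB [RHS]addrC addrA subrK.
  apply: (le_trans (cnormB _ _)).
  have := cnormM (root_seq y n - z) w; have := cnormM w (root_seq y n - z).
  have := cnorm_ge0 w; nra.
Qed.

Lemma scale_half_double x : 2^-1 *:: (x + x) = x.
Proof.
rewrite scalerDr -scalerDl -(rmorphD (real_complex R)).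
by rewrite (_ : 2^-1 + 2^-1 = 1 :> R) ?scale1r //; lra.
Qed.

Lemma double_eq0 x : x + x = 0 -> x = 0.
Proof. by move=> h; rewrite -[x]scale_half_double h scaler0. Qed.

Lemma scale_sqrt t x : 0 <= t ->
  (Num.sqrt t)%:C *: ((Num.sqrt t)%:C *: x) = t *:: x.
Proof.
by move=> t0; rewrite scalerA -(rmorphM (real_complex R)) -expr2 sqr_sqrtr.
Qed.

Lemma starZi x : star (ii *: x) = - (ii *: star x).
Proof. by rewrite starZ -scaleNr; congr (_ *: _); apply/eqP; rewrite eq_complex /= oppr0 !eqxx. Qed.

Lemma scale_ii x : ii *: (ii *: x) = - x.
Proof.
rewrite scalerA -scaleN1r; congr (_ *: _); apply/eqP.
by rewrite eq_complex /= !mul0r !mulr0 mulr1 sub0r addr0 oppr0 !eqxx.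
Qed.

Lemma sa_circle_mul v w : sa v -> sa w -> v * w = w * v ->
  (v + ii *: w) * star (v + ii *: w) = v * v + w * w.
Proof.
move=> vs ws c; rewrite starD starZi vs ws mulrBr !mulrDl -!scalerAl -!scalerAr.
by rewrite scale_ii c opprD opprK addrA addrK.
Qed.

(** After scaling, [v + i w] is unitary, and [v] is the mean of it and its
    adjoint. *)
Lemma sa_circle_norm v w t : 0 < t -> sa v -> sa w -> v * w = w * v ->
  v * v + w * w = t *:: 1 -> N (v * v) <= t.
Proof.
move=> t0 vs ws c E.
set u := v + ii *: w.
have nu : N u ^+ 2 = t.
  by rewrite -cnorm_mulstar sa_circle_mul // E cnormZr cnorm1 mulr1 gtr0_norm.
have v2 : v = 2^-1 *:: (u + star u).
  by rewrite /u starD starZi vs ws addrACA subrr addr0 scale_half_double.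
have : N v <= N u.
  rewrite v2 cnormZr ger0_norm ?invr_ge0 ?ler0n //.
  have := cnormD u (star u); rewrite cnorm_starE; lra.
rewrite cnorm_sa // -nu => h.
by rewrite ler_pXn2r // nnegrE cnorm_ge0.
Qed.

(** Positivity in a form that needs no spectrum: [h] lies in the ball of radius
    [t] around [t].  Sums of such elements are again such. *)
Definition psd h := sa h /\ exists2 t, 0 < t & N (t *:: 1 - h) <= t.

Lemma sa_scalar t : sa (t *:: 1 : A).
Proof. by rewrite starZr star1. Qed.

Lemma scalar_comm t x : (t *:: 1) * x = x * (t *:: 1).
Proof. by rewrite -scalerAl -scalerAr mul1r mulr1. Qed.

(** [h] is [t (1 - y)] with [N y <= 1], so [sqrt_one_sub] applies. *)
Lemma sqrt_scaled h t : 0 < t -> sa h -> N (t *:: 1 - h) <= t ->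
  exists s, [/\ sa s, s * s = h, N (Num.sqrt t *:: 1 - s) <= Num.sqrt t &
    forall w, w * h = h * w -> w * s = s * w].
Proof.
move=> t0 hs ht; set y := 1 - t^-1 *:: h.
have tC : t%:C != 0 by rewrite fmorph_eq0 gt_eqF.
have ty : t *:: y = t *:: 1 - h.
  by rewrite /y scalerBr fmorphV scalerA mulfV // scale1r.
have ys : sa y by rewrite /y starB star1 starZr hs.
have y1 : N y <= 1.
  by rewrite -(ler_pM2l t0) mulr1 -{1}(gtr0_norm t0) -cnormZr ty.
have [z [zs z1 zz zc]] := sqrt_one_sub ys y1.
exists (Num.sqrt t *:: (1 - z)); split.
- by rewrite starZr starB star1 zs.
- rewrite -scalerAl -scalerAr scale_sqrt ?ltW // zz /y opprB addrC subrK.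
  by rewrite fmorphV scalerA mulfV // scale1r.
- rewrite -scalerBr opprB addrC subrK cnormZr ger0_norm ?sqrtr_ge0 //.
  by rewrite ler_piMr ?sqrtr_ge0.
- move=> w c; rewrite -scalerAl -scalerAr; congr (_ *: _).
  rewrite mulrBr mulrBl mulr1 mul1r zc //.
  by rewrite /y mulrBr mulrBl mulr1 mul1r -scalerAr -scalerAl c.
Qed.

Lemma psd_sqrt h : psd h -> exists s, [/\ psd s, s * s = h &
    forall w, w * h = h * w -> w * s = s * w].
Proof.
move=> [hs [t t0 ht]]; have [s [ss sh sn sc]] := sqrt_scaled t0 hs ht.
by exists s; split => //; split => //; exists (Num.sqrt t); rewrite ?sqrtr_gt0.
Qed.

(** Take a square root [w] of [t - s^2]: then [w^2 + s^2 = t] and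
    [sa_circle_norm] bounds [w^2]. *)
Lemma norm_sub_sq s t : 0 < t -> sa s -> N (s * s) <= t ->
  N (t *:: 1 - s * s) <= t.
Proof.
move=> t0 ss h.
have as_ : sa (t *:: 1 - s * s) by rewrite starB sa_scalar starM ss.
have [w [ws ww _ wc]] : exists w, [/\ sa w, w * w = t *:: 1 - s * s,
   N (Num.sqrt t *:: 1 - w) <= Num.sqrt t &
    forall w', w' * (t *:: 1 - s * s) = (t *:: 1 - s * s) * w' -> w' * w = w * w'].
  by apply: sqrt_scaled => //; rewrite opprB addrC subrK.
rewrite -ww; apply: (@sa_circle_norm w s) => //; last by rewrite ww subrK.
by apply/esym/wc; rewrite mulrBr mulrBl scalar_comm mulrA.
Qed.

Lemma psd_sq s : sa s -> psd (s * s).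
Proof.
move=> ss; split; first by rewrite starM ss.
have t0 : 0 < N (s * s) + 1 by rewrite ltr_wpDl ?cnorm_ge0.
by exists (N (s * s) + 1) => //; apply: norm_sub_sq => //; rewrite lerDl.
Qed.

Lemma psdD a b : psd a -> psd b -> psd (a + b).
Proof.
move=> [as_ [t t0 ht]] [bs [r r0 hr]]; split; first by rewrite starD as_ bs.
exists (t + r); first exact: addr_gt0.
rewrite rmorphD scalerDl opprD addrACA.
by apply: (le_trans (cnormD _ _)); apply: lerD.
Qed.

Lemma psd0 : psd 0.
Proof. by rewrite -(mulr0 0); apply: psd_sq; rewrite star0. Qed.

Lemma psd_sum (I : Type) (r : seq I) (P : pred I) (F : I -> A) :
  (forall i, P i -> psd (F i)) -> psd (\sum_(i <- r | P i) F i).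
Proof. by move=> h; apply: big_ind => //; [exact: psd0 | exact: psdD]. Qed.

Lemma psdZ t a : 0 <= t -> psd a -> psd (t *:: a).
Proof.
move=> t0 /psd_sqrt[s [[ss _] <- _]].
have -> : t *:: (s * s) = (Num.sqrt t *:: s) * (Num.sqrt t *:: s).
  by rewrite -scalerAl -scalerAr scale_sqrt.
by apply: psd_sq; rewrite starZr ss.
Qed.

Lemma psd_mul_comm a b : psd a -> psd b -> a * b = b * a -> psd (a * b).
Proof.
move=> /psd_sqrt[s [[ss _] sa_ sc]] /psd_sqrt[r [[rs _] rb rc]] c.
have c1 : s * b = b * s by apply/esym/sc.
have c2 : s * r = r * s by apply: rc.
have -> : a * b = (s * r) * (s * r).
  by rewrite -sa_ -rb -!mulrA; congr (_ * _); rewrite !mulrA c2.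
by apply: psd_sq; rewrite starM ss rs.
Qed.

(** Commuting square roots [v] of [h] and [w] of [- h] satisfy
    [(v + i w) (v + i w)^* = v^2 + w^2 = 0], so [v + i w] and its adjoint
    [v - i w] vanish. *)
Lemma psd_anti h : psd h -> psd (- h) -> h = 0.
Proof.
move=> /psd_sqrt[v [[vs _] vh vc]] /psd_sqrt[w [[ws _] wh wc]].
have c : w * v = v * w.
  apply: vc; apply/esym; apply: (can_inj opprK).
  by rewrite -mulNr -mulrN; apply/wc.
have u0 : v + ii *: w = 0.
  apply: cnorm_eq0; apply/eqP; rewrite -sqrf_eq0 -cnorm_mulstar.
  by rewrite sa_circle_mul // vh wh subrr cnorm0.
have u1 : v - ii *: w = 0 by rewrite -{1}vs -{1}ws -starZi -starD u0 star0.
have v0 : v = 0.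
  by apply: double_eq0; rewrite -{2}(subrK (ii *: w) v) u1 add0r u0.
by rewrite -vh v0 mulr0.
Qed.

Lemma psd_norm_le a t : 0 < t -> psd a -> psd (t *:: 1 - a) -> N a <= t.
Proof.
move=> t0 /psd_sqrt[v [[vs _] va vc]] /psd_sqrt[w [[ws _] wt wc]].
rewrite -va; apply: (@sa_circle_norm v w) => //; last by rewrite va wt addrC subrK.
apply: wc; rewrite mulrBr mulrBl scalar_comm; congr (_ - _).
by apply/esym; apply: vc; rewrite -va.
Qed.

Lemma psd_norm_sub a t : N a <= t -> 0 < t -> psd a -> psd (t *:: 1 - a).
Proof.
move=> nt t0 [as_ _]; split; first by rewrite starB sa_scalar as_.
by exists t => //; rewrite opprB addrC subrK.
Qed.

Lemma psd_norm_mono a b : psd a -> psd b -> N a <= N (a + b).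
Proof.
move=> pa pb; apply/ler_addgt0Pr => e e0.
have t0 : 0 < N (a + b) + e by rewrite ltr_wpDl ?cnorm_ge0.
apply: psd_norm_le => //.
have : psd ((N (a + b) + e) *:: 1 - (a + b)).
  by apply: psd_norm_sub => //; [rewrite lerDl ltW | exact: psdD].
by move=> /psdD/(_ pb); rewrite opprD addrA subrK.
Qed.

(** Put [n = - a a^*] and [p = a^* a].  The sum of [a a^*] and [a^* a] is half a
    sum of two squares, so [p] is positive as well.  With [t = N a ^+ 2], the
    element [a (t - p) a^*] is [- n (t + n)]; its norm is at most [t^2] because
    [p] is positive, and at least that of [2 n^2], which is [2 t^2], because
    [n] is. *)
Lemma psd_neg_mulstar a : psd (- (a * star a)) -> a = 0.
Proof.
move=> pn; set n := - (a * star a) in pn; set p := star a * a.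
have pp : psd p.
  set b := a + star a; set c := ii *: (a - star a).
  have bs : sa b by rewrite /b starD starK addrC.
  have cs : sa c by rewrite /c starZi starB starK -scalerN opprB.
  have E : p = 2^-1 *:: (b * b + c * c) + n.
    have Eb : b * b = (a * a + star a * star a) + (a * star a + p).
      by rewrite /b mulrDl !mulrDr -/p [p + _]addrC addrACA.
    have Ec : c * c = (a * star a + p) - (a * a + star a * star a).
      rewrite /c -scalerAl -scalerAr scale_ii mulrBl !mulrBr -/p.
      by rewrite [- (p - _)]opprB addrACA -opprD opprB.
    have -> : b * b + c * c = (a * star a + p) + (a * star a + p).
      by rewrite Eb Ec [LHS]addrC addrA subrK.
    rewrite scale_half_double /n.
    by rewrite addrAC subrr add0r.
  rewrite E; apply: psdD => //; apply: psdZ; first by rewrite invr_ge0.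
  by apply: psdD; apply: psd_sq.
set t := N a ^+ 2.
have Nn : N n = t by rewrite /n cnormN cnorm_mulstar.
have Np : N p = t by rewrite /p cnorm_star.
have : t <= 0.
  rewrite leNgt; apply/negP => t0.
  have pt : N (t *:: 1 - p) <= t.
    have [s [[ss _] sp _]] := psd_sqrt pp.
    by rewrite -sp; apply: norm_sub_sq => //; rewrite sp Np.
  have E : a * (t *:: 1 - p) * star a = - ((t *:: 1 - n) * n + (n * n + n * n)).
    rewrite mulrBr mulrBl -scalerAr mulr1 -scalerAl mulrBl -scalerAl mul1r.
    rewrite addrA subrK opprD -scalerN /n !opprK; congr (_ - _).
    by rewrite mulrNN /p !mulrA.
  have : N ((n * n + n * n)) <= t * t.
    apply: (@le_trans _ _ (N ((t *:: 1 - n) * n + (n * n + n * n)))).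
      rewrite [(_ - n) * n + _]addrC; apply: psd_norm_mono.
        by apply: psdD; apply: psd_mul_comm.
      apply: psd_mul_comm => //; first by apply: psd_norm_sub => //; rewrite Nn.
      by rewrite mulrBr mulrBl scalar_comm.
    rewrite -cnormN -E.
    apply: (le_trans (cnormM _ _)); rewrite cnorm_starE.
    apply: (@le_trans _ _ (N a * t * N a)).
      rewrite ler_wpM2r ?cnorm_ge0 //; apply: (le_trans (cnormM _ _)).
      by rewrite ler_wpM2l ?cnorm_ge0.
    by rewrite mulrAC -expr2 -/t mulrC.
  have -> : n * n + n * n = 2 *:: (n * n).
    by rewrite (_ : 2 = 1 + 1 :> R) // rmorphD scalerDl scale1r.
  rewrite cnormZr cnorm_sa; last by case: pn.
  rewrite Nn ger0_norm // => h.
  have := mulr_gt0 t0 t0; lra.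
rewrite /t => h; apply: cnorm_eq0; apply/eqP; rewrite -sqrf_eq0.
by rewrite eq_le h sqr_ge0.
Qed.

(** Let [h = a a^*], [s] the positive square root of [h^2] and [m = s - h], which
    is twice the negative part of [h].  Then [m (s + h) = 0], so
    [(m a) (m a)^* = m h m = - m s m] is the opposite of a square.  By
    [psd_neg_mulstar], [m a = 0]; this forces [m = 0], i.e. [h = s]. *)
Lemma psd_mulstar a : psd (a * star a).
Proof.
set h := a * star a.
have hs : sa h by rewrite /h starM starK.
have [s [ps sh sc]] := psd_sqrt (psd_sq hs).
have [w [[ws _] wsq wc]] := psd_sqrt ps.
have ss : sa s by case: ps.
have hsC : h * s = s * h by apply: sc; rewrite mulrA.
have hw : h * w = w * h by apply: wc.
have sw : s * w = w * s by apply: wc.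
set m := s - h.
have ms : sa m by rewrite /m starB ss hs.
have mw : m * w = w * m by rewrite /m mulrBl mulrBr sw hw.
have mh : m * h = - (m * s).
  apply/eqP; rewrite -addr_eq0 -mulrDr /m mulrBl !mulrDr sh hsC.
  by rewrite [s * h + _]addrC subrr.
have E : (m * a) * star (m * a) = - ((m * w) * (m * w)).
  rewrite starM ms mulrA -[m * a * star a]mulrA -/h mh mulNr; congr (- _).
  by rewrite -wsq mulrA -[LHS]mulrA -mw.
have b0 : m * a = 0.
  apply: psd_neg_mulstar; rewrite E opprK; apply: psd_sq.
  by rewrite starM ms ws -mw.
have m0 : m * h = 0 by rewrite /h mulrA b0 mul0r.
have m3 : m * m = 0.
  rewrite {2}/m mulrBr m0 subr0.
  by apply: oppr_inj; rewrite -mh m0 oppr0.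
have : m = 0.
  by apply: cnorm_eq0; apply/eqP; rewrite -sqrf_eq0 -cnorm_sa // m3 cnorm0.
by move/eqP; rewrite subr_eq0 => /eqP <-.
Qed.

Lemma psd_sum_eq0 (I : finType) (P : pred I) (F : I -> A) :
  (forall i, P i -> psd (F i)) -> \sum_(i | P i) F i = 0 ->
  forall i, P i -> F i = 0.
Proof.
move=> h E i Pi; apply: psd_anti; first exact: h.
have -> : - F i = \sum_(j | P j && (j != i)) F j.
  by apply: (addrI (F i)); rewrite subrr -[LHS]E (bigD1 i).
by apply: psd_sum => j /andP[/h].
Qed.

Lemma sum_mulstar_eq0 (I : finType) (P : pred I) (y : I -> A) :
  \sum_(i | P i) y i * star (y i) = 0 -> forall i, P i -> y i = 0.
Proof.
move=> E i Pi; apply: cnorm_eq0; apply/eqP.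
rewrite -sqrf_eq0 -cnorm_mulstar.
rewrite (psd_sum_eq0 (F := fun i => y i * star (y i)) _ E) ?cnorm0 //.
by move=> j _; exact: psd_mulstar.
Qed.

End CStarAlgebra.
(** * Magic unitaries *)
Section MagicMatrices.
Variables (R : realType) (A : cstarType R).
Implicit Types (X E : finType).

Definition is_proj (p : A) := star p = p /\ p * p = p.

Lemma is_proj0 : is_proj 0.
Proof. by split; rewrite ?star0 ?mulr0. Qed.

Lemma psd_proj p : is_proj p -> psd p.
Proof. by move=> [ps pp]; rewrite -pp -{2}ps; exact: psd_mulstar. Qed.

Lemma psdMn (a : A) n : psd a -> psd (a *+ n).
Proof.
move=> pa; elim: n => [|n IH]; first by rewrite mulr0n; exact: psd0.
by rewrite mulrS; exact: psdD.
Qed.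

Lemma psd_addr_eq0 (a b : A) : psd a -> psd b -> a + b = 0 -> a = 0.
Proof.
move=> pa pb ab; apply: psd_anti => //.
by rewrite -[- a]addr0 -ab addrA addNr add0r.
Qed.

Lemma natmul_eq0 (x : A) n : (0 < n)%N -> x *+ n = 0 -> x = 0.
Proof.
move=> n0; rewrite -scaler_nat => /eqP; rewrite scaler_eq0 pnatr_eq0.
by rewrite eqn0Ngt n0 => /eqP.
Qed.

(** Compressing the sum by [q i] leaves [q i] plus the elements
    [(q i q j) (q i q j)^*] for [j] different from [i], which therefore add up
    to 0. *)
Lemma proj_sum1_ortho (I : finType) (P : pred I) (q : I -> A) :
  (forall i, P i -> is_proj (q i)) -> \sum_(i | P i) q i = 1 ->
  forall i j, P i -> P j -> i != j -> q i * q j = 0.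
Proof.
move=> hq q1 i j Pi Pj ij.
have [si qi] := hq i Pi.
apply: (@sum_mulstar_eq0 _ _ _ (fun j => P j && (j != i)) (fun j => q i * q j)); last first.
  by rewrite Pj eq_sym.
have e : q i * (\sum_(j | P j) q j) * q i = q i by rewrite q1 mulr1.
rewrite (bigD1 i) //= mulrDr mulrDl !qi in e.
have -> : \sum_(k | P k && (k != i)) q i * q k * star (q i * q k) =
   q i * (\sum_(k | P k && (k != i)) q k) * q i.
  rewrite mulr_sumr mulr_suml; apply: eq_bigr => k /andP[Pk _].
  by have [sk qk] := hq k Pk; rewrite starM si sk mulrA -[_ * _ * q k]mulrA qk.
by apply: (addrI (q i)); rewrite addr0.
Qed.

(** The quantum permutations of the subset [Z].  The matrix is indexed by the
    ambient set, so that one [q] can be restricted to several subsets; the only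
    entries constrained are those in the columns of [Z]. *)
Record magic_on X (Z : {set X}) (q : X -> X -> A) : Prop := {
  magic_out : forall x k, k \in Z -> x \notin Z -> q x k = 0 ;
  magic_proj : forall x k, x \in Z -> k \in Z -> is_proj (q x k) ;
  magic_row : forall x, x \in Z -> \sum_(k in Z) q x k = 1 ;
  magic_col : forall k, k \in Z -> \sum_(x in Z) q x k = 1
}.

Lemma magic_row_ortho X (Z : {set X}) q : magic_on Z q ->
  forall x k l, x \in Z -> k \in Z -> l \in Z -> k != l -> q x k * q x l = 0.
Proof.
move=> h x k l xZ kZ lZ kl.
apply: (@proj_sum1_ortho _ (mem Z) (q x)) => //; last exact: (magic_row h).
by move=> i iZ; apply: (magic_proj h).
Qed.

Lemma magic_col_ortho X (Z : {set X}) q : magic_on Z q ->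
  forall k x y, x \in Z -> k \in Z -> y \in Z -> x != y -> q x k * q y k = 0.
Proof.
move=> h k x y xZ kZ lZ kl.
apply: (@proj_sum1_ortho _ (mem Z) (q^~ k)) => //; last exact: (magic_col h).
by move=> i iZ; apply: (magic_proj h).
Qed.

(** The entries in question are positive and their sum is
    [#|Y| - #|Y| = 0], since all rows and columns of [Z] sum to 1 and the
    columns of [Y] are supported in [Y]. *)
Lemma magic_complement X (Z Y : {set X}) q : magic_on Z q -> {subset Y <= Z} ->
  (forall x k, k \in Y -> x \in Z -> x \notin Y -> q x k = 0) ->
  forall x k, x \in Y -> k \in Z -> k \notin Y -> q x k = 0.
Proof.
move=> h YZ hY x k xY kZ kY.
have e : \sum_(p | (p.1 \in Y) && ((p.2 \in Z) && (p.2 \notin Y))) q p.1 p.2 = 0.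
  rewrite -(pair_big (mem Y) (fun k => (k \in Z) && (k \notin Y)) q) /=.
  have e1 y : y \in Y -> \sum_(k | (k \in Z) && (k \notin Y)) q y k =
       1 - \sum_(k in Y) q y k.
    move=> yY; rewrite -(magic_row h (YZ _ yY)) [X in _ = X - _](bigID (mem Y)) /=.
    rewrite [X in X + _ - _](eq_bigl (mem Y)) => [|l]; first by rewrite addrAC subrr add0r.
    by apply: andb_idl; exact: YZ.
  rewrite (eq_bigr _ e1) sumrB exchange_big /=.
  apply/eqP; rewrite subr_eq0; apply/eqP; apply: eq_bigr => l lY.
  rewrite -(magic_col h (YZ _ lY)) (bigID (mem Y)) /= [X in _ + X]big1.
    rewrite addr0; apply: eq_bigl => y.
    by apply: andb_idl; exact: YZ.
  by move=> y /andP[yZ yY]; apply: hY.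
apply: (psd_sum_eq0 (P := fun p => (p.1 \in Y) && ((p.2 \in Z) && (p.2 \notin Y)))
   (F := fun p => q p.1 p.2) (i := (x, k)) _ e) => /=; last by rewrite xY kZ.
by move=> [y l] /= /andP[yY /andP[lZ _]]; apply/psd_proj/(magic_proj h)/lZ/YZ.
Qed.

(** Here [E] will be the edges of a multigraph, [s] the source or the target map
    and [u] the coefficients of a bi-unitary co-representation or of its
    contragradient.  For a co-action on a finite set, columns summing to 1 is
    usually a consequence of the antipode; here it comes from counting the
    fibres of [s], [d k] being the size of the fibre of [k]. *)
Lemma magic_of_unitary X E (s : E -> X) (Z : {set X}) (q : X -> X -> A)
    (u : E -> E -> A) :
  Z =i [set s e | e : E]%SET ->
  (forall x k, k \in Z -> x \notin Z -> q x k = 0) ->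
  (forall x k, x \in Z -> k \in Z -> is_proj (q x k)) ->
  (forall x, x \in Z -> \sum_(k in Z) q x k = 1) ->
  (forall i e f, i \in Z ->
     q (s e) i * u e f = if i == s f then u e f else 0) ->
  (forall e, \sum_f u e f * star (u e f) = 1) ->
  (forall f, \sum_e u e f * star (u e f) = 1) ->
  magic_on Z q.
Proof.
move=> hZ q_out q_proj q_row qu u_row u_col; split=> //.
have sZ e : s e \in Z by rewrite hZ; apply: imset_f.
pose d k := #|[pred e | s e == k]|.
have d_gt0 k : k \in Z -> (0 < d k)%N.
  by rewrite hZ => /imsetP[e _ ->]; apply/card_gt0P; exists e; rewrite inE.
(* For a fixed row [e], [q (s e) i] cuts [\sum_f u e f * star (u e f) = 1] down
   to the fibre of [i]. *)
have blk i e : i \in Z -> q (s e) i = \sum_(f | s f == i) u e f * star (u e f).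
  move=> iZ; rewrite -[LHS]mulr1 -(u_row e) mulr_sumr [RHS]big_mkcond.
  by apply: eq_bigr => f _; rewrite mulrA qu // eq_sym; case: eqP; rewrite ?mul0r.
have blkd k i : i \in Z -> q k i *+ d k =
    \sum_(f | s f == i) \sum_(e | s e == k) u e f * star (u e f).
  move=> iZ; rewrite exchange_big /= -sumr_const.
  by apply: eq_big => [e|e /eqP<-]; rewrite ?inE // blk.
have colS i : i \in Z -> \sum_(k in Z) q k i *+ d k = 1 *+ d i.
  move=> iZ; rewrite (eq_bigr _ (fun k _ => blkd k i iZ)) exchange_big /=.
  rewrite -sumr_const; apply: eq_big => // f _.
  rewrite -[in RHS](u_col f) [RHS](partition_big s (mem Z)) // => e _.
  exact: sZ.
(* [d i - d k q k i] is a sum of squares; compress it by [q k i]. *)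
have qd_lt k i : k \in Z -> i \in Z -> (d i < d k)%N -> q k i = 0.
  move=> kZ iZ lt; have [qs qq] := q_proj k i kZ iZ.
  set S := \sum_(f | s f == i) \sum_(e | s e != k)
    (q k i * u e f) * star (q k i * u e f).
  have pS : psd S by do 2!apply: psd_sum => ? _; exact: psd_mulstar.
  have tot : 1 *+ d i = q k i *+ d k +
      \sum_(f | s f == i) \sum_(e | s e != k) u e f * star (u e f).
    rewrite blkd // -big_split /= -sumr_const; apply: eq_big => // f _.
    by rewrite -[LHS](u_col f) (bigID (fun e => s e == k)).
  have e : q k i *+ d i = q k i *+ d k + S.
    have -> : q k i *+ d i = q k i * (1 *+ d i) * q k i.
      by rewrite mulrnAr mulr1 mulrnAl qq.
    rewrite tot mulrDr mulrDl mulrnAr mulrnAl !qq; congr (_ + _).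
    rewrite mulr_sumr mulr_suml; apply: eq_bigr => f _.
    rewrite mulr_sumr mulr_suml; apply: eq_bigr => g _.
    by rewrite starM qs !mulrA.
  apply: (@natmul_eq0 _ (d k - d i)); first by rewrite subn_gt0.
  apply: (psd_addr_eq0 (psdMn _ (psd_proj (q_proj k i kZ iZ))) pS).
  apply: (addrI (q k i *+ d i)); rewrite addr0 addrA -mulrnDr.
  by rewrite subnKC ?(ltnW lt).
(* Weigh the entry [k], [i] by [d k (d i - d k)], which is nonnegative where
   the entry is nonzero.  The total is the sum of the [d i ^ 2] minus that of
   the [d k ^ 2], i.e. 0. *)
have qd k i : k \in Z -> i \in Z -> d k != d i -> q k i = 0.
  move=> kZ iZ; rewrite neq_ltn => /orP[lt|]; last exact: qd_lt.
  have hsum : \sum_(p | (p.1 \in Z) && (p.2 \in Z))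
      q p.1 p.2 *+ (d p.1 * (d p.2 - d p.1)) = 0.
    rewrite -(pair_big (mem Z) (mem Z)
       (fun k i => q k i *+ (d k * (d i - d k)))) /=.
    have e1 x y : x \in Z -> y \in Z -> q x y *+ (d x * (d y - d x)) =
        q x y *+ d x *+ d y - q x y *+ (d x * d x).
      move=> xZ yZ; case: (leqP (d x) (d y)) => hd.
        by rewrite mulnBr mulrnBr ?leq_mul // mulrnA.
      by rewrite qd_lt // !mul0rn subr0.
    have -> : \sum_(x in Z) \sum_(y in Z) q x y *+ (d x * (d y - d x)) =
        \sum_(x in Z) (\sum_(y in Z) q x y *+ d x *+ d y
                      - \sum_(y in Z) q x y *+ (d x * d x)).
      apply: eq_bigr => x xZ; rewrite -sumrB.
      by apply: eq_bigr => y yZ; apply: e1.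
    rewrite sumrB exchange_big /=; apply/eqP; rewrite subr_eq0; apply/eqP.
    apply: eq_bigr => x xZ.
    by rewrite sumrMnl colS // sumrMnl q_row // mulrnA.
  apply: (@natmul_eq0 _ (d k * (d i - d k))).
    by rewrite muln_gt0 d_gt0 // subn_gt0.
  apply: (psd_sum_eq0 (P := fun p => (p.1 \in Z) && (p.2 \in Z))
    (F := fun p => q p.1 p.2 *+ (d p.1 * (d p.2 - d p.1))) (i := (k, i)) _ hsum) => /=;
    last by rewrite kZ.
  by move=> [x y] /= /andP[xZ yZ]; apply/psdMn/psd_proj/q_proj.
move=> i iZ; apply/eqP; rewrite -subr_eq0; apply/eqP.
apply: (natmul_eq0 (d_gt0 i iZ)).
rewrite mulrnBl -(colS i iZ) -sumrMnl; apply/eqP; rewrite subr_eq0; apply/eqP.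
apply: eq_bigr => k kZ; have [->//|ne] := eqVneq (d k) (d i).
by rewrite qd // !mul0rn.
Qed.

(** [Z n :&: Z m] is preserved by [q] as a subset of [Z n], because the columns
    of [Z m] are supported in [Z m]; so its complement in [Z n] is preserved
    too. *)
Lemma magic_cover_block (X : finType) (P : nat -> Prop) (Z : nat -> {set X}) q :
  (forall m, P m -> magic_on (Z m) q) ->
  forall m n x k, P m -> P n -> x \in Z m -> k \in Z n -> k \notin Z m ->
  q x k = 0.
Proof.
move=> h m n x k Pm Pn xZ kZ kZm.
have [xn|xn] := boolP (x \in Z n); last exact: (magic_out (h n Pn)).
apply: (@magic_complement _ (Z n) (Z n :&: Z m)%SET q (h n Pn)).
- by move=> y; rewrite inE => /andP[].
- move=> y l; rewrite !inE => /andP[_ lm] -> /= ym.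
  exact: (magic_out (h m Pm)).
- by rewrite inE xn.
- by [].
- by rewrite inE kZ.
Qed.

Lemma magic_cover (X : finType) (P : nat -> Prop) (Z : nat -> {set X})
    (W : {set X}) q :
  (forall x, x \in W <-> exists2 m, P m & x \in Z m) ->
  (forall m, P m -> magic_on (Z m) q) -> magic_on W q.
Proof.
move=> hW h.
have ZW m x : P m -> x \in Z m -> x \in W by move=> Pm xm; apply/hW; exists m.
have blk m x k : P m -> x \in Z m -> k \in W -> k \notin Z m -> q x k = 0.
  move=> Pm xm /hW[n Pn kn] km; exact: (magic_cover_block h Pm Pn).
have restrict m (F : X -> A) : P m ->
    (forall x, x \in W -> x \notin Z m -> F x = 0) ->
    \sum_(x in W) F x = \sum_(x in Z m) F x.
  move=> Pm hF; rewrite (bigID (mem (Z m))) /= [X in _ + X]big1 ?addr0.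
    apply: eq_bigl => x; rewrite andbC.
    by case: (boolP (x \in Z m)) => // /(ZW _ _ Pm) ->.
  by move=> x /andP[]; exact: hF.
split.
- move=> x k /hW[m Pm km] xW; apply: (magic_out (h m Pm)) => //.
  by apply: contra xW; exact: ZW.
- move=> x k /hW[m Pm xm] kW; have [km|km] := boolP (k \in Z m).
    exact: (magic_proj (h m Pm)).
  by rewrite (blk m) //; exact: is_proj0.
- move=> x /hW[m Pm xm]; rewrite (restrict m) //; first exact: (magic_row (h m Pm)).
  by move=> k; exact: blk.
- move=> k /hW[m Pm km]; rewrite (restrict m) //; first exact: (magic_col (h m Pm)).
  by move=> x _; exact: (magic_out (h m Pm)).
Qed.
End MagicMatrices.
(** * Functions on finite sets *)
Section FunctionSpaces.

Lemma sum_enum_val (V : nmodType) (I : finType) (F : I -> V) :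
  \sum_(j < #|I|) F (enum_val j) = \sum_i F i.
Proof. by rewrite -(@big_enum_val _ _ _ I predT F). Qed.

Lemma finsums_sum (V : nmodType) (S : set V) (I : finType) (F : I -> V) :
  (forall i, S (F i)) -> finsums S (\sum_i F i).
Proof.
move=> h; exists #|I|, (fun j => F (enum_val j)); split=> //.
by rewrite sum_enum_val.
Qed.

Lemma lspan_sum (K : pzRingType) (V : lmodType K) (S : set V) (I : finType)
    (F : I -> V) : (forall i, S (F i)) -> lspan S (\sum_i F i).
Proof.
move=> h; exists #|I|, (fun=> 1), (fun j => F (enum_val j)); split=> //.
by rewrite -sum_enum_val; apply: eq_bigr => j _; rewrite scale1r.
Qed.

(** This and the next lemma are stated for the property [linear], since the maps
    at hand are not bundled linear maps. *)
Lemma linear_prop0 (K : pzRingType) (V W : lmodType K) (f : V -> W) :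
  linear f -> f 0 = 0.
Proof.
move=> lf; have := lf 1 0 0; rewrite !scale1r addr0 => h.
by apply: (addrI (f 0)); rewrite addr0 -h.
Qed.

Lemma linear_prop_sum (K : pzRingType) (V W : lmodType K) (f : V -> W)
    (I : Type) (r : seq I) (c : I -> K) (g : I -> V) :
  linear f -> f (\sum_(i <- r) c i *: g i) = \sum_(i <- r) c i *: f (g i).
Proof.
move=> lf; elim/big_rec2: _ => [|i x y _ <-]; last by rewrite lf.
exact: linear_prop0.
Qed.

Variables (K : pzRingType).

Lemma ffun_chi_sum (X : finType) (f : {ffun X -> K^o}) :
  f = \sum_x (f x : K) *: chi K x.
Proof.
apply/ffunP => y; rewrite sum_ffunE (bigD1 y) //= big1 ?addr0.
  by rewrite !ffunE eqxx; exact/esym/mulr1.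
by move=> x xy; rewrite !ffunE eq_sym (negbTE xy) scaler0.
Qed.

Lemma linear_chi (X : finType) (W : lmodType K) (al : {ffun X -> K^o} -> W) f :
  linear al -> al f = \sum_x (f x : K) *: al (chi K x).
Proof. by move=> lal; rewrite {1}(ffun_chi_sum f) linear_prop_sum. Qed.

Lemma fspan_out (X : finType) (Y : {set X}) f :
  fspan K Y f -> forall x, x \notin Y -> f x = 0.
Proof.
move=> [n [c [s [hs ->]]]] x xY; rewrite sum_ffunE big1 // => i _.
have [y yY ->] := hs i; rewrite !ffunE (_ : x == y = false) ?scaler0 //.
by apply: contraNF xY => /eqP->.
Qed.

Lemma fspan_chi (X : finType) (Y : {set X}) x : x \in Y -> fspan K Y (chi K x).
Proof.
move=> xY; exists 1%N, (fun=> 1), (fun=> chi K x); split; first by exists x.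
by rewrite big_ord1 scale1r.
Qed.

Lemma ftens_set_out (X : finType) (W : lmodType K) (Y : {set X})
    (h : {ffun X -> W}) :
  (forall x, x \notin Y -> h x = 0) -> ftens_set (fspan K Y) h.
Proof.
move=> hY.
have -> : h = \sum_x (if x \in Y then ftens (chi K x) (h x) else ftens 0 0).
  apply/ffunP => y; rewrite sum_ffunE (bigD1 y) //= big1 ?addr0.
    case: ifP => yY; first by rewrite !ffunE eqxx scale1r.
    by rewrite !ffunE scaler0 hY ?yY.
  move=> x xy; case: ifP => _; rewrite !ffunE ?scaler0 //.
  by rewrite eq_sym (negbTE xy) scale0r.
apply: finsums_sum => x; case: ifP => xY.
  by exists (chi K x), (h x); split => //; exact: fspan_chi.
exists 0, 0; split => //; exists 0%N, (fun=> 0), (fun=> 0); split; first by case.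
by rewrite big_ord0.
Qed.

Lemma fext_out (W : nmodType) (X : finType) (Y : {set X})
    (f : {ffun {x : X | x \in Y} -> W}) x : x \notin Y -> fext f x = 0.
Proof. by move=> xY; rewrite ffunE insubN. Qed.

Lemma fext_val (W : nmodType) (X : finType) (Y : {set X})
    (f : {ffun {x : X | x \in Y} -> W}) y : fext f (val y) = f y.
Proof. by rewrite ffunE valK. Qed.

Lemma fres_chi (X : finType) (Y : {set X}) (y : {x : X | x \in Y}) :
  fres Y (chi K (val y)) = chi K y.
Proof. by apply/ffunP => x; rewrite !ffunE val_eqE. Qed.

Lemma ffun_mulE (X : finType) (B : pzRingType) (f g : {ffun X -> B}) x :
  (f * g) x = f x * g x.
Proof. by rewrite ffunE. Qed.

End FunctionSpaces.

(** * Co-actions given by magic unitaries *)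
Section Coactions.
Variables (R : realType) (Q : cqg R).
Local Notation C := R[i].

Lemma qg_t0l b : qg_t (0 : Q) b = 0.
Proof. exact: (linear_prop0 (min_tensor_linl (qg_tP Q) b)). Qed.

Lemma qg_t0r a : qg_t a (0 : Q) = 0.
Proof. exact: (linear_prop0 (min_tensor_linr (qg_tP Q) a)). Qed.

Lemma qg_t_sumr b (I : Type) (r : seq I) (c : I -> C) (g : I -> Q) :
  qg_t b (\sum_(i <- r) c i *: g i) = \sum_(i <- r) c i *: qg_t b (g i).
Proof. exact: (linear_prop_sum r c g (min_tensor_linr (qg_tP Q) b)). Qed.

Lemma qg_Delta_lin : linear (@qg_Delta R Q).
Proof. exact: (star_hom_linear (qg_Delta_hom Q)). Qed.

Lemma qg_Delta0 : qg_Delta (0 : Q) = 0.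
Proof. exact: (linear_prop0 qg_Delta_lin). Qed.

Definition comult_on (X : finType) (Z : {set X}) (q : X -> X -> Q) :=
  forall x k, x \in Z -> k \in Z ->
    qg_Delta (q x k) = \sum_(y in Z) qg_t (q x y) (q y k).

(** Outside a piece containing [x] or [k] one of the two factors of each term
    vanishes, by [magic_cover_block]. *)
Lemma comult_cover (X : finType) (P : nat -> Prop) (Z : nat -> {set X})
    (W : {set X}) q :
  (forall x, x \in W <-> exists2 m, P m & x \in Z m) ->
  (forall m, P m -> magic_on (Z m) q) ->
  (forall m, P m -> comult_on (Z m) q) -> comult_on W q.
Proof.
move=> hW h hc x k /hW[m Pm xm] kW.
have [n Pn kn] := (hW k).1 kW.
have [km|km] := boolP (k \in Z m).
  rewrite (hc m) // [RHS](bigID (mem (Z m))) /= [X in _ + X]big1 ?addr0.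
    apply/esym/eq_bigl => y; apply: andb_idl => ym.
    by apply/hW; exists m.
  by move=> y /andP[_ ym]; rewrite [q y k](magic_out (h m Pm)) // qg_t0r.
rewrite (magic_cover_block h Pm Pn) // qg_Delta0 big1 // => y /hW[n' Pn' yn'].
have [ym|ym] := boolP (y \in Z m).
  by rewrite [q y k](magic_cover_block h Pm Pn) // qg_t0r.
by rewrite [q x y](magic_cover_block h Pm Pn') // qg_t0l.
Qed.

Definition magic_map (X : finType) (W : {set X}) (q : X -> X -> Q)
    (f : {ffun {x : X | x \in W} -> C^o}) : {ffun {x : X | x \in W} -> Q} :=
  [ffun x => \sum_k (f k : C) *: q (val x) (val k)].
Arguments magic_map {X} W q f.

Lemma magic_map_chi (X : finType) (W : {set X}) (q : X -> X -> Q) k x :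
  magic_map W q (chi C k) x = q (val x) (val k).
Proof.
rewrite ffunE (bigD1 k) //= ffunE eqxx scale1r big1 ?addr0 // => l lk.
by rewrite ffunE (negbTE lk) scale0r.
Qed.

(** The density condition holds exactly, not only up to closure: if [al] is the
    co-action, [g] is the sum over [x], [k] of
    [al (chi k) * (1 (x) (q x k * g x))], because the columns are orthogonal and
    the rows sum to 1. *)
Lemma magic_coaction (X : finType) (W : {set X}) (q : X -> X -> Q) :
  magic_on W q -> comult_on W q -> coaction (magic_map W q).
Proof.
move=> h hc; split.
- move=> a f g; apply/ffunP => x; rewrite !ffunE scaler_sumr -big_split /=.
  by apply: eq_bigr => k _; rewrite !ffunE scalerDl scalerA.
- apply/ffunP => x; rewrite !ffunE -(magic_row h (valP x)) [RHS]big_sub.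
  by apply: eq_bigr => k _; rewrite ffunE scale1r.
- move=> f g; apply/ffunP => x; rewrite ffun_mulE !ffunE mulr_suml.
  apply: eq_bigr => k _; rewrite mulr_sumr (bigD1 k) //= big1 ?addr0.
    rewrite -scalerAl -scalerAr scalerA ffun_mulE.
    by rewrite (magic_proj h (valP x) (valP k)).2.
  move=> l lk; rewrite -scalerAl -scalerAr.
  have kl : val k != val l by rewrite (inj_eq val_inj) eq_sym.
  by rewrite (magic_row_ortho h (valP x) (valP k) (valP l) kl) !scaler0.
- move=> f; apply/ffunP => x; rewrite !ffunE star_sum; apply: eq_bigr => k _.
  by rewrite starZ ffunE (magic_proj h (valP x) (valP k)).1.
- move=> f y; rewrite ffunE linear_prop_sum; last exact: qg_Delta_lin.
  under eq_bigr => x _ do rewrite magic_map_chi ffunE qg_t_sumr.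
  rewrite exchange_big /=; apply: eq_bigr => k _.
  rewrite -scaler_sumr; congr (_ *: _).
  by rewrite (hc _ _ (valP y) (valP k)) [RHS]big_sub.
- move=> g e e0; exists g; last by move=> x; rewrite subrr cnorm0.
  have -> : g = \sum_p magic_map W q (chi C p.2) *
      ftens 1 (q (val p.1) (val p.2) * g p.1).
    apply/ffunP => y; rewrite sum_ffunE.
    rewrite -(pair_bigA _ (fun x k =>
      (magic_map W q (chi C k) * ftens 1 (q (val x) (val k) * g x)) y)) /=.
    rewrite (bigD1 y) //= [X in _ + X]big1 ?addr0.
      rewrite -[LHS]mul1r -(magic_row h (valP y)) big_sub mulr_suml.
      apply: eq_bigr => k _; rewrite ffun_mulE magic_map_chi !ffunE scale1r mulrA.
      by rewrite (magic_proj h (valP y) (valP k)).2.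
    move=> x xy; apply: big1 => k _; rewrite ffun_mulE magic_map_chi !ffunE scale1r.
    have yx : val y != val x by rewrite (inj_eq val_inj) eq_sym.
    by rewrite mulrA (magic_col_ortho h (valP y) (valP k) (valP x) yx) mul0r.
  by apply: lspan_sum => -[x k]; exists (chi C k), (q (val x) (val k) * g x).
Qed.

Lemma coaction_proj (Y : finType) (al : {ffun Y -> C^o} -> {ffun Y -> Q}) :
  coaction al -> forall x k, is_proj (al (chi C k) x).
Proof.
move=> h x k; split.
  have := coactionS h (chi C k).
  have -> : [ffun x => (chi C k x)^*%C] = chi C k.
    by apply/ffunP => y; rewrite !ffunE; case: eqP => _; rewrite ?conjc1 ?conjc0.
  by move/ffunP/(_ x); rewrite ffunE.
have := coactionM h (chi C k) (chi C k).
have -> : chi C k * chi C k = chi C k.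
  by apply/ffunP => y; rewrite ffun_mulE !ffunE; case: eqP; rewrite ?mulr1 ?mulr0.
by move/ffunP/(_ x); rewrite ffun_mulE.
Qed.

Lemma coaction_row (Y : finType) (al : {ffun Y -> C^o} -> {ffun Y -> Q}) :
  coaction al -> forall x, \sum_k al (chi C k) x = 1.
Proof.
move=> h x; have := coaction1 h; rewrite (linear_chi _ (coaction_linear h)).
move/ffunP/(_ x); rewrite sum_ffunE ffunE => <-; apply: eq_bigr => k _.
by rewrite !ffunE scale1r.
Qed.

End Coactions.
Arguments magic_map {R Q X} W q f.
(** * Matrices indexed by the edges *)
Section EdgeMatrices.
Variables (R : realType) (A : cstarType R) (E : finType).
Local Notation C := R[i].

Definition edge_mx (v : E -> E -> A) : 'M[A]_#|E| :=
  \matrix_(i, j) v (enum_val i) (enum_val j).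

Definition edge_diag (K : nmodType) (c : E -> K) : 'M[K]_#|E| :=
  diag_mx (\row_i c (enum_val i)).

Lemma edge_diagE (K : nmodType) (c : E -> K) i j :
  edge_diag c i j = if i == j then c (enum_val i) else 0.
Proof. by rewrite !mxE eq_sym; case: eqP => // ->. Qed.

Lemma edge_diag_of_diag (K : nmodType) (X : 'M[K]_#|E|) :
  (forall i j, i != j -> X i j = 0) ->
  X = edge_diag (fun e => X (enum_rank e) (enum_rank e)).
Proof.
move=> h; apply/matrixP => i j; rewrite edge_diagE enum_valK.
by case: eqP => [->//|/eqP ij]; exact: h.
Qed.

Lemma mconj_edge_mx v : mconj (edge_mx v) = edge_mx (fun e f => star (v e f)).
Proof. by apply/matrixP => i j; rewrite !mxE. Qed.

Lemma munitaryP v : munitary (edge_mx v) <->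
  (forall e f, \sum_g v e g * star (v f g) = (e == f)%:R) /\
  (forall e f, \sum_g star (v g e) * v g f = (e == f)%:R).
Proof.
have m1 i j : (edge_mx v *m madj (edge_mx v)) i j =
    \sum_g v (enum_val i) g * star (v (enum_val j) g).
  rewrite mxE -[RHS]sum_enum_val.
  by apply: eq_bigr => k _; rewrite !mxE.
have m2 i j : (madj (edge_mx v) *m edge_mx v) i j =
    \sum_g star (v g (enum_val i)) * v g (enum_val j).
  rewrite mxE -[RHS]sum_enum_val.
  by apply: eq_bigr => k _; rewrite !mxE.
split=> [[h1 h2]|[h1 h2]].
  split=> e f.
    have /matrixP/(_ (enum_rank e) (enum_rank f)) := h1.
    by rewrite m1 !enum_rankK mxE (inj_eq enum_rank_inj).
  have /matrixP/(_ (enum_rank e) (enum_rank f)) := h2.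
  by rewrite m2 !enum_rankK mxE (inj_eq enum_rank_inj).
by split; apply/matrixP => i j; rewrite ?m1 ?m2 ?h1 ?h2 !mxE (inj_eq enum_val_inj).
Qed.

Lemma mtens_edge_diag (c : E -> C) : mtens (edge_diag c) (1 : A) = edge_diag (fun e => c e *: (1 : A)).
Proof. by apply/matrixP => i j; rewrite mxE !edge_diagE; case: eqP => // _; rewrite scale0r. Qed.

Lemma Ad_edge_diag v (c : E -> C) i j : Ad (edge_mx v) (edge_diag c) i j =
  \sum_g c g *: (v (enum_val i) g * star (v (enum_val j) g)).
Proof.
rewrite /Ad mtens_edge_diag mul_mx_diag mxE -[RHS]sum_enum_val.
by apply: eq_bigr => k _; rewrite !mxE -scalerAr mulr1 scalerAl.
Qed.

(** For the indicator of a block of parallel edges, the matrix on the left is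
    the corner that enters the definition of preserved quantum symmetry. *)
Lemma compress_edge_diag (c : E -> C) (Y : 'M[A]_#|E|) i j :
  (mtens (edge_diag c) 1 *m Y *m mtens (edge_diag c) 1) i j =
  (c (enum_val i) * c (enum_val j)) *: Y i j.
Proof.
rewrite mtens_edge_diag mul_diag_mx mul_mx_diag !mxE.
by rewrite -scalerAr mulr1 -scalerAl mul1r scalerA mulrC.
Qed.

End EdgeMatrices.

Section EdgeOperatorLemmas.
Variables (R : realType) (A : cstarType R) (G : multigraph).
Local Notation C := R[i].

Lemma pE_edge_diag (K : pzRingType) (e : edge G) : pE K e = edge_diag (fun f => (f == e)%:R).
Proof.
apply/matrixP => i j; rewrite mxE edge_diagE -(inj_eq enum_rank_inj) enum_valK.
case: (eqVneq i j) => [->|ij]; first by rewrite andbb.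
by case: eqP => //= ie; rewrite -ie eq_sym (negbTE ij).
Qed.

Lemma sum_pE (K : pzRingType) (P : pred (edge G)) :
  \sum_(e | P e) pE K e = edge_diag (fun f => (P f)%:R).
Proof.
apply/matrixP => i j; rewrite summxE edge_diagE.
under eq_bigr => e _ do rewrite pE_edge_diag edge_diagE.
case: (eqVneq i j) => [_|ij]; last by rewrite big1.
case: (boolP (P (enum_val i))) => Pi; last first.
  apply: big1 => e Pe; case: eqP => // ie.
  by move: Pi; rewrite ie Pe.
by rewrite (bigD1 (enum_val i)) //= eqxx big1 ?addr0 // => e /andP[_];
  rewrite eq_sym => /negbTE->.
Qed.

Lemma pij_edge_diag (K : pzRingType) (i j : vert G) :
  pij K i j = edge_diag (fun f => (f \in Eij i j)%:R).
Proof. exact: sum_pE. Qed.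

(** The common form of [Smap] and [Tmap]: [s] is the source or the target map
    and [W] its image. *)
Definition side_map (K : pzRingType) (s : edge G -> vert G) (W : {set vert G})
   (f : {ffun {v : vert G | v \in W} -> K^o}) : 'M[K]_#|edge G| :=
  \sum_v (f v : K) *: \sum_(e | s e == val v) pE K e.
Arguments side_map K s W f : clear implicits.

Lemma side_map_edge_diag (K : pzRingType) s (W : {set vert G}) f :
  side_map K s W f = edge_diag (fun e => fext f (s e)).
Proof.
apply/matrixP => i j; rewrite summxE edge_diagE.
under eq_bigr => v _ do rewrite sum_pE mxE edge_diagE.
case: (eqVneq i j) => [_|ij]; last by rewrite big1 // => v _; rewrite mulr0.
have [w|w] := boolP (s (enum_val i) \in W); last first.
  rewrite fext_out // big1 // => v _.
  by case: eqP => [e|]; rewrite ?mulr0 //; move: w; rewrite e (valP v).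
rewrite (bigD1 (Sub (s (enum_val i)) w)) //= eqxx mulr1.
rewrite big1 ?addr0; last first.
  move=> v; rewrite -val_eqE /= eq_sym => /negbTE->.
  by rewrite mulr0.
by rewrite -(fext_val f) SubK.
Qed.

Lemma fext_chi (K : pzRingType) (X : finType) (W : {set X})
    (v : {x : X | x \in W}) x : fext (chi K v) x = (x == val v)%:R.
Proof.
have [xW|xW] := boolP (x \in W).
  by rewrite -[x]/(val (exist _ x xW)) fext_val ffunE val_eqE.
rewrite fext_out // (_ : x == val v = false) //.
by apply: contraNF xW => /eqP->; exact: valP.
Qed.

Lemma side_map_tens s (W : {set vert G}) (h : vert G -> A) :
  (forall e, s e \in W) ->
  mtens_set (range (side_map C s W)) (edge_diag (fun e => h (s e))).
Proof.
move=> sW.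
have -> : edge_diag (fun e => h (s e)) =
    \sum_v mtens (side_map C s W (chi C v)) (h (val v)).
  apply/matrixP => i j; rewrite summxE edge_diagE.
  under eq_bigr => v _ do rewrite side_map_edge_diag mxE edge_diagE.
  case: (eqVneq i j) => [_|ij]; last by rewrite big1 // => v _; rewrite scale0r.
  rewrite (bigD1 (Sub (s (enum_val i)) (sW _))) //= fext_chi eqxx scale1r.
  rewrite big1 ?addr0 // => v vi; rewrite fext_chi eq_sym.
  by move: vi; rewrite -val_eqE /= => /negbTE->; rewrite scale0r.
by apply: finsums_sum => v; exists (side_map C s W (chi C v)), (h (val v)).
Qed.

(** Moving [q] through [v] replaces the scalar [f (s g)] by the element
    [\sum_i f i *: q (s e) i], which no longer depends on the summation index
    [g]; the remaining sum is an entry of [v v^* = 1]. *)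
Lemma Ad_side_map s (W : {set vert G}) (q : vert G -> vert G -> A)
    (v : edge G -> edge G -> A) f :
  (forall e, s e \in W) ->
  (forall e f, \sum_g v e g * star (v f g) = (e == f)%:R) ->
  (forall i e f, i \in W ->
     q (s e) i * v e f = if i == s f then v e f else 0) ->
  Ad (edge_mx v) (side_map C s W f) = edge_diag (fun e => \sum_i (f i : C) *: q (s e) (val i)).
Proof.
move=> sW vv qv; apply/matrixP => a b; rewrite side_map_edge_diag Ad_edge_diag edge_diagE.
set e := enum_val a; set e' := enum_val b.
transitivity ((\sum_i (f i : C) *: (q (s e) (val i))) * \sum_g v e g * star (v e' g)).
  rewrite mulr_suml; under [RHS]eq_bigr => i _ do rewrite mulr_sumr.
  rewrite exchange_big /=; apply: eq_bigr => g _.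
  rewrite (bigD1 (Sub (s g) (sW g))) //= big1 ?addr0.
    by rewrite -scalerAl mulrA qv // eqxx -(fext_val f).
  move=> i ig; rewrite -scalerAl mulrA qv; last exact: (valP i).
  have -> : (val i == s g) = false.
    by apply/negbTE; apply: contra ig => /eqP ig; apply/eqP/val_inj.
  by rewrite mul0r scaler0.
rewrite vv (inj_eq enum_val_inj).
by case: eqP => _; rewrite ?mulr1 ?mulr0.
Qed.

Lemma Dij_edge_diag i j (X : 'M[C]_#|edge G|) : Dij i j X -> exists c, X = edge_diag c.
Proof.
move=> [Y [n [c [s [hs ->]]]] <-].
exists (fun e => (pij C i j *m (\sum_k c k *: s k) *m pij C i j)
   (enum_rank e) (enum_rank e)).
apply: edge_diag_of_diag => a b ab; rewrite pij_edge_diag mul_diag_mx mul_mx_diag !mxE summxE big1.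
  by rewrite mulr0 mul0r.
move=> k _; have [e _ <-] := hs k.
by rewrite mxE pE_edge_diag edge_diagE (negbTE ab) mulr0.
Qed.

Lemma pE_Dij (e : edge G) : Dij (src e) (tgt e) (pE C e).
Proof.
exists (pE C e).
  exists 1%N, (fun=> 1), (fun=> pE C e); split; first by exists e.
  by rewrite big_ord1 scale1r.
rewrite pij_edge_diag; apply/matrixP => a b.
rewrite mul_diag_mx mul_mx_diag [LHS]mxE [X in X * _]mxE pE_edge_diag edge_diagE.
have [<-|ab] := eqVneq a b; last by rewrite mulr0 mul0r.
have [ea|ea] := eqVneq (enum_val a) e; last by rewrite mulr0 mul0r.
by rewrite !mxE ea inE !eqxx !mulr1.
Qed.

Lemma tens_Dij_off k l (Y : 'M[A]_#|edge G|) a b :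
  mtens_set (Dij k l) Y -> a != b -> Y a b = 0.
Proof.
move=> [n [s [hs ->]]] ab; rewrite summxE big1 // => i _.
have [X [y [/Dij_edge_diag[c ->] ->]]] := hs i.
by rewrite mxE edge_diagE (negbTE ab) scale0r.
Qed.

Lemma tens_Dij k l (y : edge G -> A) :
  (forall e, e \notin Eij k l -> y e = 0) -> mtens_set (Dij k l) (edge_diag y).
Proof.
move=> hy.
have -> : edge_diag y = \sum_e (if e \in Eij k l then mtens (pE C e) (y e) else mtens 0 0).
  apply/matrixP => a b; rewrite summxE edge_diagE.
  have [<-|ab] := eqVneq a b; last first.
    rewrite big1 // => e _; case: ifP => _; last by rewrite mxE scaler0.
    by rewrite mxE pE_edge_diag edge_diagE (negbTE ab) scale0r.
  rewrite (bigD1 (enum_val a)) //= big1 ?addr0.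
    case: ifP => h; last by rewrite mxE scaler0 hy ?h.
    by rewrite mxE pE_edge_diag edge_diagE !eqxx scale1r.
  move=> e ea; case: ifP => _; last by rewrite mxE scaler0.
  by rewrite mxE pE_edge_diag edge_diagE eqxx eq_sym (negbTE ea) scale0r.
apply: finsums_sum => e; case: ifP => ekl.
  exists (pE C e), (y e); split => //.
  by move: ekl; rewrite inE => /andP[/eqP<- /eqP<-]; exact: pE_Dij.
exists 0, 0; split => //; exists 0; last by rewrite mulmx0 mul0mx.
by exists 0%N, (fun=> 0), (fun=> 0); split; [case | rewrite big_ord0].
Qed.

(** [Ad] of the projection on [g] has entries [v e g * star (v f g)], and an
    element of [D_kl (x) A] is a diagonal matrix, so the block condition says
    that the off-diagonal entries over a block of parallel edges vanish. *)
Lemma parallelP (v : edge G -> edge G -> A) :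
  (forall i j k l : vert G, Eij i j != finset.set0 -> Eij k l != finset.set0 ->
   forall X, Dij i j X ->
    mtens_set (Dij k l)
      (mtens (pij C k l) (1 : A) *m Ad (edge_mx v) X *m mtens (pij C k l) 1)) <->
  (forall e f g, e != f -> src e = src f -> tgt e = tgt f ->
     v e g * star (v f g) = 0).
Proof.
split=> [h e f g ef sef tef|h i j k l _ _ X /Dij_edge_diag[c ->]].
  have en : Eij (src e) (tgt e) != finset.set0.
    by apply/set0Pn; exists e; rewrite inE !eqxx.
  have gn : Eij (src g) (tgt g) != finset.set0.
    by apply/set0Pn; exists g; rewrite inE !eqxx.
  have := h _ _ _ _ gn en _ (pE_Dij g).
  move/tens_Dij_off => /(_ (enum_rank e) (enum_rank f)).
  rewrite (inj_eq enum_rank_inj) => /(_ ef).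
  rewrite pij_edge_diag compress_edge_diag !enum_rankK !inE -sef -tef !eqxx mulr1 scale1r.
  rewrite pE_edge_diag Ad_edge_diag !enum_rankK (bigD1 g) //= eqxx scale1r big1 ?addr0 //.
  by move=> g' /negbTE->; rewrite scale0r.
set Y := _ *m _ *m _.
have Ye a b : Y a b = ((enum_val a \in Eij k l)%:R * (enum_val b \in Eij k l)%:R) *:
    \sum_g c g *: (v (enum_val a) g * star (v (enum_val b) g)).
  by rewrite /Y pij_edge_diag compress_edge_diag Ad_edge_diag.
rewrite (@edge_diag_of_diag _ _ Y).
  apply: tens_Dij => e ekl.
  by rewrite Ye enum_rankK (negbTE ekl) mul0r scale0r.
move=> a b ab; rewrite Ye.
case: (boolP (enum_val a \in _)) => [|_]; last by rewrite mul0r scale0r.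
case: (boolP (enum_val b \in _)) => [|_]; last by rewrite mulr0 scale0r.
rewrite !inE => /andP[/eqP s1 /eqP t1] /andP[/eqP s2 /eqP t2].
rewrite big1 ?scaler0 // => g _.
by rewrite h ?scaler0 ?s1 ?s2 ?t1 ?t2 // (inj_eq enum_val_inj).
Qed.

End EdgeOperatorLemmas.
(** * Preserved quantum symmetry in terms of coefficients *)
Section Coefficients.
Variables (R : realType) (Q : cqg R).
Local Notation C := R[i].

(** The coefficients of a co-action on [C(W)], extended by 0 to the ambient set
    [X]. *)
Definition coaction_coef (X : finType) (W : {set X})
    (al : {ffun {x : X | x \in W} -> C^o} -> {ffun {x : X | x \in W} -> Q})
    (x k : X) : Q := fext (al (fres W (chi C k))) x.

Lemma coaction_coef_val (X : finType) (W : {set X}) al (x k : {x : X | x \in W}) :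
  coaction_coef al (val x) (val k) = al (chi C k) x.
Proof. by rewrite /coaction_coef fres_chi fext_val. Qed.

Lemma coaction_coef_proj (X : finType) (W : {set X})
   (al : {ffun {x : X | x \in W} -> C^o} -> {ffun {x : X | x \in W} -> Q}) :
  coaction al -> forall x k, x \in W -> k \in W -> is_proj (coaction_coef al x k).
Proof.
move=> ca x k xW kW.
rewrite -[x]/(val (exist _ x xW)) -[k]/(val (exist _ k kW)) coaction_coef_val.
exact: coaction_proj.
Qed.

Lemma coaction_coef_magic (X E : finType) (W : {set X})
    (al : {ffun {x : X | x \in W} -> C^o} -> {ffun {x : X | x \in W} -> Q})
    (s : E -> X) (v : E -> E -> Q) :
  coaction al -> W =i [set s e | e : E]%SET ->
  (forall i e f, i \in W ->
     coaction_coef al (s e) i * v e f = if i == s f then v e f else 0) ->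
  (forall e, \sum_f v e f * star (v e f) = 1) ->
  (forall f, \sum_e v e f * star (v e f) = 1) ->
  magic_on W (coaction_coef al) /\ comult_on W (coaction_coef al).
Proof.
move=> ca hW qv row col; split.
  apply: (magic_of_unitary hW) qv row col.
  - by move=> x k _ xW; exact: fext_out.
  - exact: coaction_coef_proj.
  - move=> x xW; rewrite big_sub -[x]/(val (exist _ x xW)).
    by under eq_bigr => k _ do rewrite coaction_coef_val; exact: coaction_row.
move=> x k xW kW.
rewrite -[x]/(val (exist _ x xW)) -[k]/(val (exist _ k kW)) coaction_coef_val.
rewrite -(coactionA ca) [RHS]big_sub; apply: eq_bigr => y _.
by rewrite !coaction_coef_val.
Qed.

Lemma coaction_coef_magic_map (X : finType) (W : {set X}) q :
  magic_on W q -> forall x k, k \in W -> coaction_coef (magic_map W q) x k = q x k.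
Proof.
move=> h x k kW; have [xW|xW] := boolP (x \in W).
  rewrite -[x in LHS]/(val (exist _ x xW)) -[k in LHS]/(val (exist _ k kW)).
  by rewrite coaction_coef_val magic_map_chi.
by rewrite [LHS]fext_out // (magic_out h).
Qed.

Lemma fext_magic_map (X : finType) (W Y : {set X}) (q : X -> X -> Q) f x :
  magic_on W q -> Y \subset W -> fspan C Y f ->
  fext (magic_map W q (fres W f)) x = \sum_(k in Y) (f k : C) *: q x k.
Proof.
move=> h YW fY; have f0 := fspan_out fY.
have [xW|xW] := boolP (x \in W); last first.
  rewrite fext_out // big1 // => k kY.
  by rewrite (magic_out h) ?scaler0 // (fintype.subsetP YW).
rewrite -[x in LHS]/(val (exist _ x xW)) fext_val ffunE /=.
under eq_bigr => k _ do rewrite ffunE.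
rewrite -(big_sub (mem W) (fun k => (f k : C) *: q x k)).
rewrite (bigID (mem Y)) /= [X in _ + X]big1 ?addr0.
  by apply: eq_bigl => k; apply: andb_idl; exact: (fintype.subsetP YW).
by move=> k /andP[_ kY]; rewrite f0 // scale0r.
Qed.

(** All the conditions of [preserves_symmetry], read on coefficients; [qs] and
    [qt] are those of the induced co-actions on sources and targets.  The four
    unitarity relations are those of the matrix [u] and of its entrywise
    adjoint. *)
Record symmetry_coef (G : multigraph) (u : edge G -> edge G -> Q)
    (qs qt : vert G -> vert G -> Q) : Prop := {
  sc_comult : forall x y, qg_Delta (u x y) = \sum_z qg_t (u x z) (u z y) ;
  sc_UUa : forall e f, \sum_g u e g * star (u f g) = (e == f)%:R ;
  sc_UaU : forall e f, \sum_g star (u g e) * u g f = (e == f)%:R ;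
  sc_VVa : forall e f, \sum_g star (u e g) * u f g = (e == f)%:R ;
  sc_VaV : forall e f, \sum_g u g e * star (u g f) = (e == f)%:R ;
  sc_src : forall i e f, i \in Vs G ->
    qs (src e) i * u e f = if i == src f then u e f else 0 ;
  sc_tgt : forall j e f, j \in Vt G ->
    u e f * qt (tgt e) j = if j == tgt f then u e f else 0 ;
  sc_row : forall e, \sum_f u e f = 1 ;
  sc_par : forall e f g, e != f -> src e = src f -> tgt e = tgt f ->
    u e g * star (u f g) = 0 ;
  sc_par_star : forall e f g, e != f -> src e = src f -> tgt e = tgt f ->
    star (u e g) * u f g = 0 ;
  sc_magic_src : magic_on (Vs G) qs ;
  sc_magic_tgt : magic_on (Vt G) qt ;
  sc_comult_src : comult_on (Vs G) qs ;
  sc_comult_tgt : comult_on (Vt G) qt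
}.

Section Graph.
Variable G : multigraph.
Variable beta : {ffun edge G -> C^o} -> {ffun edge G -> Q}.
Let u (x y : edge G) : Q := beta (chi C y) x.

Lemma corep_edge_mx : corep_mx beta = edge_mx u.
Proof. by []. Qed.

Lemma contra_edge_mx : contra_mx beta = edge_mx (fun e f => star (u e f)).
Proof. by rewrite /contra_mx corep_edge_mx mconj_edge_mx. Qed.

Lemma src_Vs (e : edge G) : src e \in Vs G.
Proof. exact: imset_f. Qed.

Lemma tgt_Vt (e : edge G) : tgt e \in Vt G.
Proof. exact: imset_f. Qed.

Lemma lact_chi (i : vert G) (f : edge G) :
  lact (chi C i) (chi C f) = if i == src f then chi C f else 0 :> {ffun edge G -> C^o}.
Proof.
apply/ffunP => e; rewrite !ffunE; case: (eqVneq i (src f)) => [->|ne].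
  by rewrite ffunE; case: (eqVneq e f) => [->|_]; rewrite ?eqxx ?mulr1 ?mulr0.
rewrite ffunE; case: (eqVneq e f) => [->|_]; last by rewrite mulr0.
by rewrite eq_sym (negbTE ne) mul0r.
Qed.

Lemma ract_chi (j : vert G) (f : edge G) :
  ract (chi C f) (chi C j) = if j == tgt f then chi C f else 0 :> {ffun edge G -> C^o}.
Proof.
apply/ffunP => e; rewrite !ffunE; case: (eqVneq j (tgt f)) => [->|ne].
  by rewrite ffunE; case: (eqVneq e f) => [->|_]; rewrite ?eqxx ?mul1r ?mul0r.
rewrite ffunE; case: (eqVneq e f) => [->|_]; last by rewrite mul0r.
by rewrite eq_sym (negbTE ne) mulr0.
Qed.

Lemma induced_srcP als : linear beta -> induced_src beta als <->
  coaction als /\ forall i e f, i \in Vs G ->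
    coaction_coef als (src e) i * u e f = if i == src f then u e f else 0.
Proof.
move=> lb; split=> -[ca h]; split=> //.
  move=> i e f iW; have /ffunP/(_ e) := h (exist _ i iW) f.
  rewrite lact_chi ffunE /coaction_coef -[i in fres _ (chi C i)]/(val (exist _ i iW)).
  rewrite fres_chi => -> /=; case: ifP => // _.
  by rewrite linear_prop0 // ffunE.
move=> i f; apply/ffunP => e; rewrite lact_chi ffunE.
have := h (val i) e f (valP i); rewrite /coaction_coef fres_chi => ->.
by case: ifP => // _; rewrite linear_prop0 // ffunE.
Qed.

Lemma induced_tgtP alt : linear beta -> induced_tgt beta alt <->
  coaction alt /\ forall j e f, j \in Vt G ->
    u e f * coaction_coef alt (tgt e) j = if j == tgt f then u e f else 0.
Proof.
move=> lb; split=> -[ca h]; split=> //.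
  move=> i e f iW; have /ffunP/(_ e) := h (exist _ i iW) f.
  rewrite ract_chi ffunE /coaction_coef -[i in fres _ (chi C i)]/(val (exist _ i iW)).
  rewrite fres_chi => -> /=; case: ifP => // _.
  by rewrite linear_prop0 // ffunE.
move=> i f; apply/ffunP => e; rewrite ract_chi ffunE.
have := h (val i) e f (valP i); rewrite /coaction_coef fres_chi => ->.
by case: ifP => // _; rewrite linear_prop0 // ffunE.
Qed.

Lemma fixed_rowP : linear beta ->
  beta (\sum_e chi C e) = ftens (\sum_e chi C e) 1 <-> forall e, \sum_f u e f = 1.
Proof.
move=> lb.
have E e : beta (\sum_f chi C f) e = \sum_f u e f.
  rewrite (eq_bigr (fun f => 1 *: chi C f)) => [|f _]; last by rewrite scale1r.
  rewrite linear_prop_sum // sum_ffunE; apply: eq_bigr => f _.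
  by rewrite scale1r.
have E1 e : (\sum_f chi C f) e = 1.
  rewrite sum_ffunE (bigD1 e) //= ffunE eqxx big1 ?addr0 // => f fe.
  by rewrite ffunE eq_sym (negbTE fe).
split=> [h e|h]; first by rewrite -E h ffunE E1 scale1r.
by apply/ffunP => e; rewrite E h ffunE E1 scale1r.
Qed.

Lemma biunitaryP : biunitary beta <->
  [/\ forall e f, \sum_g u e g * star (u f g) = (e == f)%:R,
      forall e f, \sum_g star (u g e) * u g f = (e == f)%:R,
      forall e f, \sum_g star (u e g) * u f g = (e == f)%:R &
      forall e f, \sum_g u g e * star (u g f) = (e == f)%:R].
Proof.
rewrite /biunitary contra_edge_mx corep_edge_mx; split.
  move=> [/munitaryP[h1 h2] /munitaryP[h3 h4]]; split=> // e f.
    by rewrite -h3; apply: eq_bigr => g _; rewrite starK.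
  by rewrite -h4; apply: eq_bigr => g _; rewrite starK.
move=> [h1 h2 h3 h4]; split; apply/munitaryP; split=> // e f.
  by rewrite -h3; apply: eq_bigr => g _; rewrite starK.
by rewrite -h4; apply: eq_bigr => g _; rewrite starK.
Qed.

Lemma symmetry_coefP als alt : preserves_symmetry beta ->
  induced_src beta als -> induced_tgt beta alt ->
  symmetry_coef u (coaction_coef als) (coaction_coef alt).
Proof.
move=> [[[lb hD] [bu [_ _ _ x0]]] hp] /(induced_srcP _ lb)[cs hs]
  /(induced_tgtP _ lb)[ct ht].
have /biunitaryP[h1 h2 h3 h4] := bu.
have ht' i e f : i \in Vt G ->
    coaction_coef alt (tgt e) i * star (u e f) = if i == tgt f then star (u e f) else 0.
  move=> iW; rewrite -{1}(coaction_coef_proj ct (tgt_Vt e) iW).1 -starM ht //.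
  by case: ifP; rewrite ?star0.
have [ms1 ms2] : magic_on (Vs G) (coaction_coef als) /\ comult_on (Vs G) (coaction_coef als).
  by apply: (coaction_coef_magic cs _ hs) => // e; rewrite ?h1 ?h4 eqxx.
have [mt1 mt2] : magic_on (Vt G) (coaction_coef alt) /\ comult_on (Vt G) (coaction_coef alt).
  apply: (coaction_coef_magic ct _ ht') => // e.
    by under eq_bigr => f _ do rewrite starK; rewrite h3 eqxx.
  by under eq_bigr => f _ do rewrite starK; rewrite h2 eqxx.
split => //.
- exact/fixed_rowP.
- apply/(parallelP u) => i j k l h h' X hX.
  by have [] := hp i j k l h h' X hX.
- move=> e f g ef se te.
  have /(parallelP (fun e f => star (u e f))) hh :
    forall i j k l : vert G, Eij i j != finset.set0 -> Eij k l != finset.set0 ->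
    forall X, Dij i j X -> mtens_set (Dij k l)
      (mtens (pij C k l) (1 : Q) *m Ad (edge_mx (fun e f => star (u e f))) X
         *m mtens (pij C k l) 1).
    move=> i j k l h h' X hX; rewrite -contra_edge_mx.
    by have [] := hp i j k l h h' X hX.
  by have := hh e f g ef se te; rewrite starK.
Qed.

(** The invariance of [S(C(V^s))] and [T(C(V^t))] is a consequence of the
    relations [sc_src] and [sc_tgt], by [Ad_side_map]. *)
Lemma preserves_symmetryI qs qt : linear beta -> symmetry_coef u qs qt ->
  (forall x k, k \in Vs G -> k \in Vt G -> qs x k = qt x k) ->
  preserves_symmetry beta.
Proof.
move=> lb sc agree.
have ms := sc_magic_src sc; have mt := sc_magic_tgt sc.
have cs := magic_coaction ms (sc_comult_src sc).
have ct := magic_coaction mt (sc_comult_tgt sc).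
have is_ : induced_src beta (magic_map (Vs G) qs).
  apply/induced_srcP => //; split=> // i e f iW.
  by rewrite coaction_coef_magic_map // (sc_src sc).
have it_ : induced_tgt beta (magic_map (Vt G) qt).
  apply/induced_tgtP => //; split=> // i e f iW.
  by rewrite coaction_coef_magic_map // (sc_tgt sc).
have qtu j e f : j \in Vt G ->
    qt (tgt e) j * star (u e f) = if j == tgt f then star (u e f) else 0.
  move=> jW; rewrite -{1}(magic_proj mt (tgt_Vt e) jW).1 -starM (sc_tgt sc) //.
  by case: ifP; rewrite ?star0.
split; first split; first by split=> //; exact: (sc_comult sc).
- split; first by apply/biunitaryP; split; case: sc.
  split.
  + move=> _ [f _ <-].
    rewrite corep_edge_mx (Ad_side_map (q := qs) f src_Vs (sc_UUa sc) (sc_src sc)).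
    exact: (side_map_tens (fun x => \sum_i (f i : C) *: qs x (val i)) src_Vs).
  + move=> _ [f _ <-]; rewrite contra_edge_mx.
    rewrite (Ad_side_map (q := qt) f tgt_Vt _ qtu).
      exact: (side_map_tens (fun x => \sum_i (f i : C) *: qt x (val i)) tgt_Vt).
    by move=> e g; rewrite -(sc_VVa sc); apply: eq_bigr => h _; rewrite starK.
  + exists (magic_map (Vs G) qs), (magic_map (Vt G) qt); split=> // f ff.
    have es x := fext_magic_map x ms (subsetIl _ _) ff.
    have et x := fext_magic_map x mt (subsetIr _ _) ff.
    have E : fext (magic_map (Vs G) qs (fres (Vs G) f)) =
             fext (magic_map (Vt G) qt (fres (Vt G) f)).
      apply/ffunP => x; rewrite es et; apply: eq_bigr => k.
      by rewrite inE => /andP[ks kt]; rewrite agree.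
    have out : ftens_set (fspan C (Vs G :&: Vt G)%SET)
        (fext (magic_map (Vs G) qs (fres (Vs G) f))).
      apply: ftens_set_out => x; rewrite inE negb_and => /orP[xs|xt].
        by rewrite fext_out.
      by rewrite E fext_out.
    by split; rewrite -?E.
  + exact/fixed_rowP/(sc_row sc).
- move=> i j k l h h' X hX; split.
    by apply: (parallelP u).2 hX => //; exact: (sc_par sc).
  rewrite contra_edge_mx; apply: (parallelP _).2 hX => // e f g ef se te.
  by rewrite starK (sc_par_star sc).
Qed.

(** [e] lies in the uniform component of degree [mult e]. *)
Definition mult (e : edge G) := #|Eij (src e) (tgt e)|.

Lemma mem_Em e m : (e \in Em G m) = (mult e == m).
Proof. by rewrite inE. Qed.

Lemma mult_parallel e f : src e = src f -> tgt e = tgt f -> mult e = mult f.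
Proof. by rewrite /mult => -> ->. Qed.

(** The double counting in a block of parallel edges.  [p] is the common value
    of its row sums and column sums. *)
Lemma coef_mult qs qt : symmetry_coef u qs qt ->
  forall e f, mult e != mult f -> u e f = 0.
Proof.
move=> sc e f nm.
have ms := sc_magic_src sc; have mt := sc_magic_tgt sc.
pose B (g h : edge G) := (g \in Eij (src h) (tgt h)).
pose p := qs (src e) (src f) * qt (tgt e) (tgt f).
have rowB e' : B e' e -> \sum_(g | B g f) u e' g = p.
  rewrite /B inE => /andP[/eqP se /eqP te].
  rewrite /p -[qs _ _]mulr1 -(sc_row sc e') mulr_sumr mulr_suml.
  rewrite [LHS]big_mkcond; apply: eq_bigr => g _; rewrite -se -te.
  rewrite (sc_src sc) ?src_Vs // inE.
  case: (eqVneq (src g) (src f)) => /= [sg|sg]; last first.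
    by rewrite mul0r.
  by rewrite (sc_tgt sc) ?tgt_Vt // eq_sym.
(* A unitary that fixes the constant vector has an adjoint that fixes it. *)
have col1 g : \sum_e' u e' g = 1.
  have : \sum_e' star (u e' g) = 1.
    transitivity (\sum_e' \sum_h star (u e' g) * u e' h).
      apply: eq_bigr => e' _.
      by rewrite -mulr_sumr (sc_row sc) mulr1.
    rewrite exchange_big /=; under eq_bigr => h _ do rewrite (sc_UaU sc).
    rewrite (bigD1 g) //= eqxx big1 ?addr0 // => h.
    by rewrite eq_sym => /negbTE->.
  by rewrite -star_sum => /(congr1 (@star _ _)); rewrite starK star1.
have colB g : B g f -> \sum_(e' | B e' e) u e' g = p.
  rewrite /B inE => /andP[/eqP sg /eqP tg].
  rewrite /p -[qs _ _]mulr1 -(col1 g) mulr_sumr mulr_suml.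
  rewrite [LHS]big_mkcond; apply: eq_bigr => e' _; rewrite inE.
  have -> : u e' g = qs (src e') (src f) * u e' g * qt (tgt e') (tgt f).
    by rewrite (sc_src sc) ?src_Vs // -sg eqxx (sc_tgt sc) ?tgt_Vt // tg eqxx.
  case: (eqVneq (src e') (src e)) => /= [->|se]; last first.
    by rewrite !mulrA (magic_col_ortho ms) ?src_Vs ?mul0r // eq_sym.
  rewrite !mulrA (magic_proj ms (src_Vs _) (src_Vs _)).2.
  case: (eqVneq (tgt e') (tgt e)) => /= [->|te].
    by rewrite -!mulrA (magic_proj mt (tgt_Vt _) (tgt_Vt _)).2.
  by rewrite -!mulrA (magic_col_ortho mt) ?tgt_Vt ?mulr0.
have cB h : #|[pred g | B g h]| = mult h.
  by apply: eq_card => g; rewrite !inE.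
have pmn : p *+ mult e = p *+ mult f.
  rewrite -!cB -!sumr_const.
  transitivity (\sum_(e' | B e' e) \sum_(g | B g f) u e' g).
    by apply: eq_big => // e' /rowB->.
  by rewrite exchange_big /=; apply/esym; apply: eq_big => // g /colB->.
have p0 : p = 0.
  have key a b : (a < b)%N -> p *+ a = p *+ b -> p = 0.
    move=> ab h; apply: (@natmul_eq0 _ _ _ (b - a)); first by rewrite subn_gt0.
    by rewrite mulrnBr ?(ltnW ab) // h subrr.
  by move: nm; rewrite neq_ltn => /orP[/key|/key]; apply.
have Bff : B f f by rewrite /B inE !eqxx.
have Bee : B e e by rewrite /B inE !eqxx.
have : (\sum_(e' | B e' e) u e' f) * star (u e f) = 0.
  by rewrite colB // p0 mul0r.
rewrite mulr_suml (bigD1 e) //= big1 ?addr0 => [h|e' /andP[]].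
  by apply: cnorm_eq0; apply/eqP; rewrite -sqrf_eq0 -cnorm_mulstar h cnorm0.
rewrite /B inE => /andP[/eqP se /eqP te] ne.
exact: (sc_par sc).
Qed.

End Graph.

Lemma preserves_component (G : multigraph)
    (beta : {ffun edge G -> C^o} -> {ffun edge G -> Q}) :
  preserves_symmetry beta -> forall m xi, fspan C (Em G m) xi ->
  ftens_set (fspan C (Em G m)) (beta xi).
Proof.
move=> hb m xi /fspan_out xi0.
have [[[lb _] [_ [_ _ [als [alt [is_ it_ _]]] _]]] _] := hb.
have sc := symmetry_coefP hb is_ it_.
apply: ftens_set_out => e; rewrite mem_Em => em.
rewrite (linear_chi _ lb) sum_ffunE big1 // => f _.
have [fm|fm] := boolP (f \in Em G m); last by rewrite xi0 // scale0r ffunE.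
rewrite ffunE (coef_mult sc) ?scaler0 //.
by move: fm; rewrite mem_Em => /eqP->.
Qed.

End Coefficients.
(** * The direct sum of the uniform components *)
Section Transfer.
Variables (R : realType) (Q : cqg R).

(** The components have their own vertex types, and this moves a magic unitary on
    one of them to the vertices of the whole multigraph. *)
Lemma magic_transfer (X' X : finType) (j : X' -> X) (Z : {set X'})
    (q' : X' -> X' -> Q) (q : X -> X -> Q) :
  injective j -> magic_on Z q' -> comult_on Z q' ->
  (forall x k, k \in Z -> q (j x) (j k) = q' x k) ->
  (forall x k, k \in Z -> x \notin codom j -> q x (j k) = 0) ->
  magic_on (j @: Z)%SET q /\ comult_on (j @: Z)%SET q.
Proof.
move=> ij h hc qq q0.
have sumj (V : nmodType) (F : X -> V) :
    \sum_(x in (j @: Z)%SET) F x = \sum_(x in Z) F (j x).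
  by apply: big_imset => x y _ _; exact: ij.
split; last first.
  move=> _ _ /imsetP[x xZ ->] /imsetP[k kZ ->]; rewrite qq // hc // sumj.
  by apply: eq_bigr => y yZ; rewrite !qq.
split.
- move=> x _ /imsetP[k kZ ->] xZ.
  have [/codomP[x' E]|xj] := boolP (x \in codom j); last exact: q0.
  rewrite E qq // (magic_out h) //; apply: contra xZ => x'Z.
  by rewrite E; apply: imset_f.
- move=> _ _ /imsetP[x xZ ->] /imsetP[k kZ ->]; rewrite qq //.
  exact: (magic_proj h).
- move=> _ /imsetP[x xZ ->]; rewrite sumj -(magic_row h xZ).
  by apply: eq_bigr => k kZ; rewrite qq.
- move=> _ /imsetP[k kZ ->]; rewrite sumj -(magic_col h kZ).
  by apply: eq_bigr => x xZ; rewrite qq.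
Qed.

End Transfer.

Section DirectSum.
Variables (R : realType) (Q : cqg R) (G : multigraph).
Local Notation C := R[i].
Local Notation Gm := (uniform_component G).
Variable beta : forall m, {ffun edge (Gm m) -> C^o} -> {ffun edge (Gm m) -> Q}.
Variable alpha : forall m, {ffun vert (Gm m) -> C^o} -> {ffun vert (Gm m) -> Q}.
Hypothesis betaP : forall m, Em G m != finset.set0 ->
  preserves_symmetry (@beta m) /\ induced_perm (@beta m) (@alpha m).
Hypothesis alphaP : forall m n, Em G m != finset.set0 -> Em G n != finset.set0 ->
  m <> n -> forall f : {ffun vert G -> C^o},
  fspan C (Vm G m :&: Vm G n)%SET f ->
  @fext _ _ (Vm G m) (alpha (fres (Vm G m) f)) =
  @fext _ _ (Vm G n) (alpha (fres (Vm G n) f)).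

Let u (x y : edge G) : Q := corep_sum beta (chi C y) x.
Let um m (x y : edge (Gm m)) : Q := beta (chi C y) x.

Lemma Em_mult (e : edge G) : e \in Em G (mult e).
Proof. by rewrite mem_Em. Qed.

Lemma Em_neq0 m (e : edge G) : e \in Em G m -> Em G m != finset.set0.
Proof. by move=> em; apply/set0Pn; exists e. Qed.

Lemma beta_linear m : Em G m != finset.set0 -> linear (@beta m).
Proof. by move=> /betaP[[[[]]]]. Qed.

Lemma corep_sumE xi m (x : edge (Gm m)) :
  corep_sum beta xi (val x) = beta (fres (Em G m) xi) x.
Proof.
have mx := valP x; rewrite mem_Em in mx.
have mlt : (m < #|edge G|.+1)%N by rewrite ltnS -(eqP mx) max_card.
rewrite /corep_sum sum_ffunE (bigD1 (Ordinal mlt)) //= fext_val big1 ?addr0 //.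
move=> n; rewrite -val_eqE /= => nm; apply: fext_out.
by rewrite mem_Em (eqP mx) eq_sym.
Qed.

Lemma corep_sum_linear : linear (corep_sum beta).
Proof.
move=> a f g; apply/ffunP => e.
rewrite -[e]/(val (exist _ e (Em_mult e) : edge (Gm (mult e)))).
set e' := exist _ _ _; rewrite ffunE [in RHS]ffunE !corep_sumE.
have -> : fres (Em G (mult e)) (a *: f + g) =
    a *: fres (Em G (mult e)) f + fres (Em G (mult e)) g.
  by apply/ffunP => y; rewrite !ffunE.
by rewrite beta_linear ?(Em_neq0 (Em_mult e)) // !ffunE.
Qed.

Lemma coef_val m (x y : edge (Gm m)) : u (val x) (val y) = um x y.
Proof. by rewrite /u corep_sumE fres_chi. Qed.

Lemma coef_diff e f : mult e != mult f -> u e f = 0.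
Proof.
move=> ef; rewrite /u -[e]/(val (exist _ e (Em_mult e) : edge (Gm (mult e)))).
rewrite corep_sumE.
have -> : fres (Em G (mult e)) (chi C f) = 0.
  apply/ffunP => y; rewrite !ffunE; case: eqP => // E.
  by move: (valP y) ef; rewrite E mem_Em => /eqP->; rewrite eqxx.
by rewrite linear_prop0 ?ffunE //; exact/beta_linear/(Em_neq0 (Em_mult e)).
Qed.

(** The co-actions [alpha m] as one matrix: the column [k] is taken from the
    component of any edge incident to [k], and [gluedE] shows that every
    component containing [k] gives the same column. *)
Definition glued (x k : vert G) : Q :=
  if [pick e | (src e == k) || (tgt e == k)] is Some e then
    @fext _ _ (Vm G (mult e)) (alpha (fres (Vm G (mult e)) (chi C k))) x
  else 0.

Lemma Vm_neq0 m k : k \in Vm G m -> Em G m != finset.set0.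
Proof. by rewrite inE => /existsP[e /andP[em _]]; exact: (Em_neq0 em). Qed.

Lemma gluedE m x k : k \in Vm G m ->
  glued x k = @fext _ _ (Vm G m) (alpha (fres (Vm G m) (chi C k))) x.
Proof.
move=> km; rewrite /glued; case: pickP => [e ek|none]; last first.
  move: km; rewrite inE => /existsP[e /andP[_]].
  by have := none e; rewrite eq_sym [tgt e == _]eq_sym => ->.
have kn : k \in Vm G (mult e).
  rewrite inE; apply/existsP; exists e; rewrite Em_mult /=.
  by rewrite eq_sym [k == tgt e]eq_sym.
have [->//|nm] := eqVneq (mult e) m.
rewrite (alphaP (Vm_neq0 kn) (Vm_neq0 km)) //; first exact/eqP.
by apply: fspan_chi; rewrite inE kn.
Qed.

Lemma glued_out m x k : k \in Vm G m -> x \notin Vm G m -> glued x k = 0.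
Proof. by move=> km xm; rewrite (gluedE _ km) fext_out. Qed.

Lemma component_coef m : Em G m != finset.set0 ->
  exists qs qt, [/\ symmetry_coef (@um m) qs qt,
    forall x k, k \in Vs (Gm m) -> glued (val x) (val k) = qs x k &
    forall x k, k \in Vt (Gm m) -> glued (val x) (val k) = qt x k].
Proof.
move=> /betaP[ps [_ [als [alt [is_ it_ es et]]]]].
exists (coaction_coef als), (coaction_coef alt); split; first exact: symmetry_coefP.
  move=> x k kV; rewrite (gluedE _ (valP k)) fres_chi fext_val.
  have := es (exist _ k kV); rewrite /= => ->.
  by rewrite /coaction_coef -fres_chi.
move=> x k kV; rewrite (gluedE _ (valP k)) fres_chi fext_val.
have := et (exist _ k kV); rewrite /= => ->.
by rewrite /coaction_coef -fres_chi.
Qed.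

(** The sources of the edges of [E_m], as vertices of [G]. *)
Definition Zs m : {set vert G} := (val @: Vs (Gm m))%SET.
Definition Zt m : {set vert G} := (val @: Vt (Gm m))%SET.

Lemma src_Zs m e : e \in Em G m -> src e \in Zs m.
Proof.
move=> em; pose e' : edge (Gm m) := exist _ e em.
by apply/imsetP; exists (src e') => //; exact: src_Vs.
Qed.

Lemma tgt_Zt m e : e \in Em G m -> tgt e \in Zt m.
Proof.
move=> em; pose e' : edge (Gm m) := exist _ e em.
by apply/imsetP; exists (tgt e') => //; exact: tgt_Vt.
Qed.

Lemma Vs_cover x : x \in Vs G <-> exists2 m, Em G m != finset.set0 & x \in Zs m.
Proof.
split=> [/imsetP[e _ ->]|[m _ /imsetP[k /imsetP[e _ ->] ->]]].
  exists (mult e); first exact: (Em_neq0 (Em_mult e)).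
  exact: src_Zs (Em_mult e).
exact: src_Vs.
Qed.

Lemma Vt_cover x : x \in Vt G <-> exists2 m, Em G m != finset.set0 & x \in Zt m.
Proof.
split=> [/imsetP[e _ ->]|[m _ /imsetP[k /imsetP[e _ ->] ->]]].
  exists (mult e); first exact: (Em_neq0 (Em_mult e)).
  exact: tgt_Zt (Em_mult e).
exact: tgt_Vt.
Qed.

Lemma codom_val_Vm m (x : vert G) :
  x \notin codom (val : vert (Gm m) -> vert G) -> x \notin Vm G m.
Proof.
by apply: contra => xm; apply/codomP; exists (exist _ x xm).
Qed.

Lemma glued_magic_src m : Em G m != finset.set0 ->
  magic_on (Zs m) glued /\ comult_on (Zs m) glued.
Proof.
move=> /component_coef[qs [qt [sc es _]]].
apply: (magic_transfer val_inj (sc_magic_src sc) (sc_comult_src sc)) => //.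
by move=> x k _ /codom_val_Vm; apply: glued_out; exact: valP.
Qed.

Lemma glued_magic_tgt m : Em G m != finset.set0 ->
  magic_on (Zt m) glued /\ comult_on (Zt m) glued.
Proof.
move=> /component_coef[qs [qt [sc _ et]]].
apply: (magic_transfer val_inj (sc_magic_tgt sc) (sc_comult_tgt sc)) => //.
by move=> x k _ /codom_val_Vm; apply: glued_out; exact: valP.
Qed.

Lemma sum_component m (V : nmodType) (F : edge G -> V) :
  (forall e, e \notin Em G m -> F e = 0) ->
  \sum_e F e = \sum_(e : edge (Gm m)) F (val e).
Proof.
move=> h; rewrite (bigID (mem (Em G m))) /= [X in _ + X]big1 //.
by rewrite addr0 big_sub.
Qed.

Lemma edge_component (P : edge G -> Prop) :
  (forall m (e : edge (Gm m)), Em G m != finset.set0 -> P (val e)) -> forall e, P e.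
Proof.
move=> h e.
exact: (h (mult e) (exist _ e (Em_mult e)) (Em_neq0 (Em_mult e))).
Qed.

(** A statement on pairs of edges need only be checked for pairs of different
    multiplicity and for pairs inside one component. *)
Lemma edge_component2 (P : edge G -> edge G -> Prop) :
  (forall e f, mult e != mult f -> P e f) ->
  (forall m (e f : edge (Gm m)), Em G m != finset.set0 -> P (val e) (val f)) ->
  forall e f, P e f.
Proof.
move=> h0 h e f; have [ef|] := eqVneq (mult e) (mult f); last exact: h0.
have fe : f \in Em G (mult e) by rewrite mem_Em ef.
exact: (h (mult e) (exist _ e (Em_mult e)) (exist _ f fe) (Em_neq0 fe)).
Qed.

Lemma coef_notin m (e : edge (Gm m)) g : g \notin Em G m -> u (val e) g = 0.
Proof.
move=> gm; apply: coef_diff; move: (valP e) gm.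
by rewrite !mem_Em => /eqP->; rewrite eq_sym.
Qed.

Lemma coef_notin' m (e : edge (Gm m)) g : g \notin Em G m -> u g (val e) = 0.
Proof.
move=> gm; apply: coef_diff; move: (valP e) gm.
by rewrite !mem_Em => /eqP->.
Qed.

(** [glued] serves for sources and targets alike, which makes the two induced
    co-actions agree on their common vertices.  The only relation that involves
    several components at once is [glued (src e) i * u e f] for a source [i]
    outside the component of [e]; there the entry of [glued] is 0 by
    [magic_cover_block], and [i] is not the source of [f]. *)
Lemma direct_sum_coef : symmetry_coef u glued glued.
Proof.
have ms m hm := (@glued_magic_src m hm).1.
have mt m hm := (@glued_magic_tgt m hm).1.
have cs m hm := (@glued_magic_src m hm).2.
have ct m hm := (@glued_magic_tgt m hm).2.
have vne e f : mult e != mult f -> (e == f) = false.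
  by apply: contraNF => /eqP->.
have dich e f g : mult e != mult f -> u e g = 0 \/ u f g = 0.
  move=> ef; have [eg|/coef_diff->] := eqVneq (mult e) (mult g); last by left.
  by right; apply: coef_diff; rewrite -eg eq_sym.
have dich' e f g : mult e != mult f -> u g e = 0 \/ u g f = 0.
  move=> ef; have [eg|/coef_diff->] := eqVneq (mult g) (mult e); last by left.
  by right; apply: coef_diff; rewrite eg.
split.
- apply: edge_component2 => [e f ef|m e f /component_coef[qs [qt [sc _ _]]]].
    rewrite coef_diff // qg_Delta0 big1 // => g _.
    have [eg|/coef_diff->] := eqVneq (mult e) (mult g); last by rewrite qg_t0l.
    by rewrite [u g f]coef_diff ?qg_t0r // -eg.
  rewrite (sum_component (m := m)) => [|g gm]; last by rewrite coef_notin ?qg_t0l.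
  by under eq_bigr => g _ do rewrite !coef_val; rewrite coef_val (sc_comult sc).
- apply: edge_component2 => [e f ef|m e f /component_coef[qs [qt [sc _ _]]]].
    rewrite vne // big1 // => g _.
    by have [->|->] := dich _ _ g ef; rewrite ?star0 ?mulr0 ?mul0r.
  rewrite (sum_component (m := m)) => [|g gm]; last by rewrite coef_notin ?mul0r.
  by under eq_bigr => g _ do rewrite !coef_val; rewrite (sc_UUa sc) (inj_eq val_inj).
- apply: edge_component2 => [e f ef|m e f /component_coef[qs [qt [sc _ _]]]].
    rewrite vne // big1 // => g _.
    by have [->|->] := dich' _ _ g ef; rewrite ?star0 ?mulr0 ?mul0r.
  rewrite (sum_component (m := m)) => [|g gm]; last by rewrite [u g (val f)]coef_notin' ?mulr0.
  by under eq_bigr => g _ do rewrite !coef_val; rewrite (sc_UaU sc) (inj_eq val_inj).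
- apply: edge_component2 => [e f ef|m e f /component_coef[qs [qt [sc _ _]]]].
    rewrite vne // big1 // => g _.
    by have [->|->] := dich _ _ g ef; rewrite ?star0 ?mulr0 ?mul0r.
  rewrite (sum_component (m := m)) => [|g gm]; last by rewrite [u (val f) g]coef_notin ?mulr0.
  by under eq_bigr => g _ do rewrite !coef_val; rewrite (sc_VVa sc) (inj_eq val_inj).
- apply: edge_component2 => [e f ef|m e f /component_coef[qs [qt [sc _ _]]]].
    rewrite vne // big1 // => g _.
    by have [->|->] := dich' _ _ g ef; rewrite ?star0 ?mulr0 ?mul0r.
  rewrite (sum_component (m := m)) => [|g gm]; last by rewrite [u g (val e)]coef_notin' ?mul0r.
  by under eq_bigr => g _ do rewrite !coef_val; rewrite (sc_VaV sc) (inj_eq val_inj).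
- move=> i e f iV; move: e f.
  apply: edge_component2 => [e f ef|m e f hm].
    by rewrite coef_diff // mulr0; case: ifP.
  have [qs [qt [sc es _]]] := component_coef hm.
  have [n hn iZn] := (Vs_cover i).1 iV.
  have [/imsetP[i' i'V ->]|iZ] := boolP (i \in Zs m).
    by rewrite coef_val -[src (val e)]/(val (src e)) es // (sc_src sc) // -val_eqE.
  rewrite (magic_cover_block ms hm hn) ?src_Zs ?(valP e) // mul0r.
  by case: eqP => // E; move: iZ; rewrite E src_Zs ?(valP f).
- move=> i e f iV; move: e f.
  apply: edge_component2 => [e f ef|m e f hm].
    by rewrite coef_diff // mul0r; case: ifP.
  have [qs [qt [sc _ et]]] := component_coef hm.
  have [n hn iZn] := (Vt_cover i).1 iV.
  have [/imsetP[i' i'V ->]|iZ] := boolP (i \in Zt m).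
    by rewrite coef_val -[tgt (val e)]/(val (tgt e)) et // (sc_tgt sc) // -val_eqE.
  rewrite (magic_cover_block mt hm hn) ?tgt_Zt ?(valP e) // mulr0.
  by case: eqP => // E; move: iZ; rewrite E tgt_Zt ?(valP f).
- apply: edge_component => m e /component_coef[qs [qt [sc _ _]]].
  rewrite (sum_component (m := m)) => [|g]; last exact: coef_notin.
  by under eq_bigr => g _ do rewrite coef_val; rewrite (sc_row sc).
- move=> e f g ef se te; move: g e f ef se te.
  apply: (@edge_component (fun g => forall e f, _)) => m g hm e f ef se te.
  have [em|em] := boolP (e \in Em G m); last by rewrite coef_notin' ?mul0r.
  have fm : f \in Em G m by move: em; rewrite !mem_Em (mult_parallel se te).
  have [qs [qt [sc _ _]]] := component_coef hm.
  pose e' : edge (Gm m) := exist _ e em; pose f' : edge (Gm m) := exist _ f fm.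
  rewrite -[e]/(val e') -[f]/(val f') !coef_val.
  by apply: (sc_par sc) => //; apply: val_inj.
- move=> e f g ef se te; move: g e f ef se te.
  apply: (@edge_component (fun g => forall e f, _)) => m g hm e f ef se te.
  have [em|em] := boolP (e \in Em G m); last by rewrite coef_notin' ?star0 ?mul0r.
  have fm : f \in Em G m by move: em; rewrite !mem_Em (mult_parallel se te).
  have [qs [qt [sc _ _]]] := component_coef hm.
  pose e' : edge (Gm m) := exist _ e em; pose f' : edge (Gm m) := exist _ f fm.
  rewrite -[e]/(val e') -[f]/(val f') !coef_val.
  by apply: (sc_par_star sc) => //; apply: val_inj.
- exact: (magic_cover Vs_cover ms).
- exact: (magic_cover Vt_cover mt).
- exact: (comult_cover Vs_cover ms cs).
- exact: (comult_cover Vt_cover mt ct).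
Qed.

Lemma corep_sum_preserves : preserves_symmetry (corep_sum beta).
Proof.
by apply: (preserves_symmetryI corep_sum_linear direct_sum_coef).
Qed.

End DirectSum.
Theorem proposition3p22 (R : realType) (Q : cqg R) (G : multigraph)
    (hG : no_isolated_vertex G) :
  (forall beta : {ffun edge G -> R[i]^o} -> {ffun edge G -> Q},
     preserves_symmetry beta ->
     forall m : nat, Em G m != finset.set0 ->
     forall xi, fspan R[i] (Em G m) xi ->
       ftens_set (fspan R[i] (Em G m)) (beta xi))
  /\
  (forall (beta : forall m : nat,
             {ffun edge (uniform_component G m) -> R[i]^o} ->
             {ffun edge (uniform_component G m) -> Q})
          (alpha : forall m : nat,
             {ffun vert (uniform_component G m) -> R[i]^o} ->
             {ffun vert (uniform_component G m) -> Q}),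
     (forall m : nat, Em G m != finset.set0 ->
        preserves_symmetry (beta m) /\ induced_perm (beta m) (alpha m)) ->
     (forall m n : nat, Em G m != finset.set0 -> Em G n != finset.set0 ->
        m <> n ->
        forall f : {ffun vert G -> R[i]^o},
          fspan R[i] (Vm G m :&: Vm G n)%SET f ->
          @fext _ _ (Vm G m) (alpha m (fres (Vm G m) f)) =
          @fext _ _ (Vm G n) (alpha n (fres (Vm G n) f))) ->
     preserves_symmetry (corep_sum beta)).

Proof.
split=> [beta hb m _ xi|beta alpha hb ha]; first exact: preserves_component.
exact: corep_sum_preserves hb ha.
Qed.
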